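(* Let $\psi=\psi^{(n)}\colon\{0,1\}^n\to\mathcal{B}_n$ ($n$ even) be the family of bijections defined in the context. Then both $\psi$ and $\psi^{-1}$ are computable in DLOGTIME-uniform $\mathbf{TC}^0$, i.e., by DLOGTIME-uniform families of constant-depth, polynomial-size circuits with unbounded fan-in AND, OR, NOT and majority gates.
   Context: $|x|$ denotes the Hamming weight of a binary string $x$, $\circ$ denotes concatenation, and $\mathcal{B}_n=\{x\in\{0,1\}^{n+1}: |x|>n/2\}$. For $\psi^{-1}$, the input is an element of $\mathcal{B}_n\subset\{0,1\}^{n+1}$. Marking stage. Given $x\in\{0,1\}^n$, all coordinates start unmarked. Repeatedly choose two unmarked coordinates $p<q$ with no unmarked coordinate strictly between them and with $x_p=1$, $x_q=0$, and mark both; stop when no such pair exists. The final set of marked coordinates does not depend on the choices made. When the process stops, the unmarked bits, read from left to right, form a string $0\cdots01\cdots1$. Chains. Let $i_1<\dots<i_m$ be the finally unmarked coordinates of $x$ (so $m\equiv n \pmod 2$), and let $k=(n-m)/2$. The chain containing $x$ is $\{c_k,c_{k+1},\dots,c_{n-k}\}$, where $c_r$ (for $k\le r\le n-k$) agrees with $x$ on all marked coordinates, equals $0$ on the $m-(r-k)$ leftmost unmarked coordinates and equals $1$ on the remaining $r-k$ unmarked coordinates. Then $|c_r|=r$. These chains (the De Bruijn–Tengbergen–Kruyswijk chains) partition $\{0,1\}^n$. The map $\psi$. For even $n$ and $x\in\{0,1\}^n$ lying in the chain $\{c_k,\dots,c_{n-k}\}$ with $x=c_j$, \[ \psi(x)=\begin{cases}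 c_{\frac{(n-k)+j}{2}}\circ 1, & j\equiv n-k \pmod 2,\\[2pt] c_{\frac{(n-k)+j+1}{2}}\circ 0, & j\not\equiv n-k \pmod 2.\end{cases} \] This is a bijection from $\{0,1\}^n$ to $\mathcal{B}_n$. *)

(* Defs.v *)
From HB Require Import structures.
From mathcomp Require Import all_boot.

Set Implicit Arguments.
Unset Strict Implicit.
Unset Printing Implicit Defensive.

(** * The bijection psi

    A bit string of length [n] is an [n.-tuple bool], read from left to right;
    [true] is the bit 1. *)

Definition weight (n : nat) (x : n.-tuple bool) : nat := count id x.

(* Members have length n.+1; the threshold is n/2. *)
Definition heavy (n : nat) : {set n.+1.-tuple bool} :=
  [set y | n < 2 * weight y].

Section Marking.

Variables (n : nat) (x : n.-tuple bool).

Definition markable (M : {set 'I_n}) (pq : 'I_n * 'I_n) : bool :=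
  [&& pq.1 < pq.2, pq.1 \notin M, pq.2 \notin M,
      [forall r : 'I_n, (pq.1 < r < pq.2) ==> (r \in M)],
      tnth x pq.1 & ~~ tnth x pq.2].

Definition mark_step (M : {set 'I_n}) : {set 'I_n} :=
  if [pick pq | markable M pq] is Some pq then pq.1 |: (pq.2 |: M) else M.

(* One run of the marking process, the choices being those made by [pick].
   Every effective step marks two new coordinates, so that the process has
   stopped after n steps. *)
Definition marked : {set 'I_n} := iter n mark_step set0.

Definition unmarked : {set 'I_n} := ~: marked.

Definition chain_min : nat := (n - #|unmarked|)./2.
Definition chain_max : nat := n - chain_min.

(* The element c_r of the chain of x, for chain_min <= r <= chain_max: an
   unmarked coordinate is 0 exactly when fewer than m - (r - k) unmarked
   coordinates lie to its left, where m = #|unmarked| and k = chain_min. *)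
Definition chain (r : nat) : n.-tuple bool :=
  [tuple if i \in marked then tnth x i
         else #|unmarked| - (r - chain_min)
                <= #|[set u in unmarked | u < i]| | i < n].

(* The j such that x = c_j, found by searching c_k, ..., c_(n-k). *)
Definition chain_index : nat :=
  chain_min + index x [seq chain r | r <- iota chain_min #|unmarked|.+1].

Definition psi : n.+1.-tuple bool :=
  if odd chain_index == odd chain_max
  then [tuple of rcons (chain (chain_max + chain_index)./2) true]
  else [tuple of rcons (chain (chain_max + chain_index).+1./2) false].

End Marking.

(* The inverse of psi; only its values on [heavy n], n even, are meaningful. *)
Definition psi_inv (n : nat) (y : n.+1.-tuple bool) : n.-tuple bool :=
  odflt [tuple of nseq n false] [pick x | psi x == y].

(* The families psi^(n) and (psi^(n))^-1, n even, as graphs of partial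
   functions from strings to strings. *)
Inductive psi_graph : seq bool -> seq bool -> Prop :=
  PsiGraph (n : nat) (x : n.-tuple bool) of ~~ odd n : psi_graph x (psi x).

Inductive psi_inv_graph : seq bool -> seq bool -> Prop :=
  PsiInvGraph (n : nat) (y : n.+1.-tuple bool) of ~~ odd n & y \in heavy n :
    psi_inv_graph y (psi_inv y).

(** * Threshold circuits *)

Inductive gate (n : nat) : Type :=
  | Input of 'I_n
  | And
  | Or
  | Not
  | Maj.

Arguments And {n}.
Arguments Or {n}.
Arguments Not {n}.
Arguments Maj {n}.

(* The gates are numbered 0, ..., csize - 1, in no particular order;
   [wire g h] means that [h] is a child of [g], i.e. feeds into [g]. *)
Record circuit (n : nat) : Type := Circuit {
  csize : nat;
  gtype : 'I_csize -> gate n;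
  wire : rel 'I_csize;
  outputs : seq 'I_csize
}.

Definition well_formed (n : nat) (c : circuit n) : Prop :=
  forall g : 'I_(csize c),
    match gtype g with
    | Input _ => #|[pred h | wire g h]| = 0
    | Not => #|[pred h | wire g h]| = 1
    | _ => True
    end.

(* Every directed path has at most d wires; in particular, c is acyclic. *)
Definition depth_le (n : nat) (c : circuit n) (d : nat) : Prop :=
  forall (g : 'I_(csize c)) (p : seq 'I_(csize c)),
    path (@wire n c) g p -> size p <= d.

(* The value of a gate. The recursion is on [fuel]; in an acyclic circuit
   [csize c] is always enough. A majority gate outputs 1 when strictly more
   than half of its inputs are 1. *)
Fixpoint gate_val (n : nat) (c : circuit n) (x : n.-tuple bool) (fuel : nat)
    (g : 'I_(csize c)) {struct fuel} : bool :=
  if fuel is fuel'.+1 then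
    let v := gate_val x fuel' in
    match gtype g with
    | Input i => tnth x i
    | And => [forall h, wire g h ==> v h]
    | Or => [exists h, wire g h && v h]
    | Not => [forall h, wire g h ==> ~~ v h]
    | Maj => #|[pred h | wire g h]| < 2 * #|[pred h | wire g h && v h]|
    end
  else false.

Definition circuit_val (n : nat) (c : circuit n) (x : n.-tuple bool) :
    seq bool :=
  [seq gate_val x (csize c) g | g <- outputs c].

(** * Deterministic logarithmic time

    Multitape Turing machines with random access to their input, as in
    Barrington, Immerman and Straubing, "On uniformity within NC^1". *)

(* One-way infinite tapes, blank beyond [cells]. *)
Record tape (G : Type) : Type := Tape { cells : seq G; head_pos : nat }.

Variant move : Type := MoveLeft | MoveRight | Stay.

Definition tape_read (G : Type) (blank : G) (t : tape G) : G :=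
  nth blank (cells t) (head_pos t).

(* A left move from the leftmost cell has no effect. *)
Definition tape_act (G : Type) (blank : G) (t : tape G) (a : G * move) :
    tape G :=
  Tape (set_nth blank (cells t) (head_pos t) a.1)
       match a.2 with
       | MoveLeft => (head_pos t).-1
       | MoveRight => (head_pos t).+1
       | Stay => head_pos t
       end.

(* The address tape has alphabet [option bool], with [None] as blank. It is
   read with the least significant bit in the leftmost cell, a blank counting
   as 0. *)
Definition address (t : tape (option bool)) : nat :=
  \sum_(i < size (cells t)) (nth None (cells t) i == Some true) * 2 ^ i.

(* [delta] receives the state, the input letter at the current address ([None]
   if the input has no such letter), the letter scanned on the address tape
   and those scanned on the [ntapes] work tapes. *)
Record machine (A : finType) : Type := Machine {
  state : finType;
  letter : finType;
  blank : letter;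
  ntapes : nat;
  start : state;
  verdict : state -> option bool;
  delta : state -> option A -> option bool -> {ffun 'I_ntapes -> letter} ->
    state * (option bool * move) * {ffun 'I_ntapes -> letter * move}
}.

Arguments blank {A} m.
Arguments start {A} m.

Record config (A : finType) (m : machine A) : Type := Config {
  cstate : state m;
  caddress : tape (option bool);
  cwork : 'I_(ntapes m) -> tape (letter m)
}.

Definition init (A : finType) (m : machine A) : config m :=
  Config (start m) (Tape [::] 0) (fun _ => Tape [::] 0).

(* A state [q] with [verdict q = Some b] is halting: accepting if [b],
   rejecting otherwise. *)
Definition step (A : finType) (m : machine A) (w : seq A) (c : config m) :
    config m :=
  if verdict (cstate c) is Some _ then c
  else
    let: (q, a, acts) :=
      delta (cstate c) (onth w (address (caddress c)))
        (tape_read None (caddress c))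
        [ffun i => tape_read (blank m) (cwork c i)] in
    Config q (tape_act None (caddress c) a)
      (fun i => tape_act (blank m) (cwork c i) (acts i)).

Definition decides_within (A : finType) (m : machine A) (L : seq A -> Prop)
    (time : nat -> nat) : Prop :=
  forall w : seq A, exists (t : nat) (b : bool),
    [/\ t <= time (size w),
        verdict (cstate (iter t (step w) (init m))) = Some b
      & b <-> L w].

Definition DLOGTIME (A : finType) (L : seq A -> Prop) : Prop :=
  exists (m : machine A) (c : nat),
    decides_within m L (fun N => c * (trunc_log 2 N).+1).

(** * DLOGTIME-uniform TC^0 *)

(* Binary numeral without leading zeros, least significant bit first; the
   numeral of 0 is empty. *)
Definition numeral (a : nat) : seq bool :=
  mkseq (fun i => odd (a %/ 2 ^ i)) (up_log 2 a.+1).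

Variant item : Type :=
  | IsInput | IsAnd | IsOr | IsNot | IsMaj | IsWire | IsOutput.

Definition item_code (t : item) : nat :=
  match t with
  | IsInput => 0 | IsAnd => 1 | IsOr => 2 | IsNot => 3 | IsMaj => 4
  | IsWire => 5 | IsOutput => 6
  end.

(* The description of a circuit, as a set of triples (t, a, b). *)
Definition connection (n : nat) (c : circuit n) (t : item) (a b : nat) :
    Prop :=
  match t with
  | IsInput => exists (g : 'I_(csize c)) (i : 'I_n),
      [/\ a = g, b = i & gtype g = Input i]
  | IsAnd => exists g : 'I_(csize c), [/\ a = g, b = 0 & gtype g = And]
  | IsOr => exists g : 'I_(csize c), [/\ a = g, b = 0 & gtype g = Or]
  | IsNot => exists g : 'I_(csize c), [/\ a = g, b = 0 & gtype g = Not]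
  | IsMaj => exists g : 'I_(csize c), [/\ a = g, b = 0 & gtype g = Maj]
  | IsWire => exists g h : 'I_(csize c), [/\ a = g, b = h & wire g h]
  | IsOutput => exists g : 'I_(csize c), a = g /\ onth (outputs c) b = Some g
  end.

(* Words over the alphabet {0, 1, #}: [Some b] is the bit [b], [None] is #. *)
Definition symbol : Type := option bool.

Definition encode (t : item) (a b : nat) (y : seq symbol) : seq symbol :=
  map Some (numeral (item_code t)) ++ None ::
  map Some (numeral a) ++ None ::
  map Some (numeral b) ++ None :: y.

(* The direct connection language of a family: the words t#a#b#y where
   (t, a, b) belongs to the description of the circuit for inputs of length
   |y|. The padding y is arbitrary, since a logarithmic time machine cannot
   read it entirely. *)
Definition direct_connection_language (C : forall n, circuit n)
    (w : seq symbol) : Prop :=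
  exists (t : item) (a b : nat) (y : seq symbol),
    w = encode t a b y /\ connection (C (size y)) t a b.

Definition dlogtime_uniform (C : forall n, circuit n) : Prop :=
  DLOGTIME (direct_connection_language C).

Definition polynomial_size (C : forall n, circuit n) : Prop :=
  exists k : nat, forall n : nat, csize (C n) <= n ^ k + k.

Definition constant_depth (C : forall n, circuit n) : Prop :=
  exists d : nat, forall n : nat, depth_le (C n) d.

(* R is the graph of a partial function from strings to strings; nothing is
   required of the circuits on inputs outside of its domain. *)
Definition computes (C : forall n, circuit n)
    (R : seq bool -> seq bool -> Prop) : Prop :=
  forall u v : seq bool, R u v -> circuit_val (C (size u)) (in_tuple u) = v.

Definition uniform_TC0 (R : seq bool -> seq bool -> Prop) : Prop :=
  exists C : forall n, circuit n,
    [/\ forall n, well_formed (C n), constant_depth C, polynomial_size C,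
        dlogtime_uniform C & computes C R].

(* Main.v *)
From HB Require Import structures.
From mathcomp Require Import all_boot zify.
From Stdlib Require Import FunctionalExtensionality.
Require Import Defs.

(** The machine knows n only after all numerals have been read, and it can afford a constant number
    of comparisons carried along one pass. Hence wires and outputs depend on fields only through a
    [relation], a table of comparisons, and one machine serves every [spec]; the semantics sees the
    same wires as intervals of indices. Interleaving makes the fields of a number independent of n
    and puts bit j of both fields into one tape cell. Taking all numbers below 16 * 4 ^ len n as
    gates turns being a gate into a condition on the lengths of the fields; tags without purpose are
    childless [Or] gates.

    The choices made by [pick] are never followed. The three properties in [matching] already
    determine the marked set, and since only the values on marked positions enter the balance
    conditions, a relabelling that keeps the unmarked part sorted keeps the marks. This is why the
    inverse can recompute the marks from the image. *)

(* Read 1 as an opening and 0 as a closing bracket: a 0 at position i is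
   unmarked iff zeros outnumber ones on every interval ending at i, and dually
   for a 1; these are conjunctions of majorities. Unmarked zeros precede
   unmarked ones, so that psi turns the right half of the unmarked zeros into
   ones and records in the last bit whether their number is even, and its
   inverse turns back as many of the leftmost unmarked ones. Both thus take a
   few more layers of majority gates comparing numbers of unmarked positions.

   For uniformity, the number of a gate consists of a four-bit tag and of two
   fields, whose bits are interleaved, and the children of a gate are defined
   by comparisons of fields. After finding the length N of its input by binary
   search and copying the three numerals, the machine obtains n by subtraction
   and all the comparisons in a single pass, least significant bits first. *)

Set Implicit Arguments.
Unset Strict Implicit.
Unset Printing Implicit Defensive.

(** * Binary digits *)

Definition bit (x i : nat) : bool := odd (x %/ 2 ^ i).

Lemma bit_zero x : bit x 0 = odd x.
Proof. by rewrite /bit expn0 divn1. Qed.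

Lemma bitS x i : bit x i.+1 = bit x./2 i.
Proof. by rewrite /bit expnS divnMA divn2. Qed.

Lemma bit0 i : bit 0 i = false.
Proof. by rewrite /bit div0n. Qed.

Lemma bit_inj x y : bit x =1 bit y -> x = y.
Proof.
have main n : forall x y, x + y <= n -> bit x =1 bit y -> x = y.
  elim: n => [|n IH] {}x {}y le_n eqxy; first by lia.
  have odd_eq : odd x = odd y by rewrite -!bit_zero.
  have [xy0|xy_gt0] := posnP (x + y); first by lia.
  have : x./2 = y./2; last by lia.
  by apply: IH => [|i]; [lia | rewrite -!bitS].
exact: main (leqnn _).
Qed.

Lemma bit_shift x k i : bit (x %/ 2 ^ k) i = bit x (k + i).
Proof. by rewrite /bit expnD divnMA. Qed.

Lemma bit_small x k j : x < 2 ^ k -> k <= j -> bit x j = false.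
Proof.
move=> ltxk lekj; rewrite /bit divn_small //.
by apply: leq_trans ltxk _; rewrite leq_exp2l.
Qed.

Lemma bit_small_ltn x k : (forall j, k <= j -> bit x j = false) -> x < 2 ^ k.
Proof.
move=> x_hi; rewrite -[2 ^ k]mul1n -ltn_divLR ?expn_gt0 // ltnS leqn0.
apply/eqP/bit_inj => i; rewrite bit_shift bit0; apply: x_hi.
exact: leq_addr.
Qed.

Lemma modn_bit x j : x %% 2 ^ j.+1 = x %% 2 ^ j + bit x j * 2 ^ j.
Proof.
have e1 := divn_eq x (2 ^ j); have e2 := divn_eq x (2 ^ j.+1).
have e3 : x %/ 2 ^ j.+1 = (x %/ 2 ^ j)./2 by rewrite expnSr divnMA divn2.
have := odd_double_half (x %/ 2 ^ j); rewrite -/(bit x j) => e4.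
rewrite -e4 mulnDl in e1; rewrite e3 expnSr in e2 *; move: e1 e2.
by rewrite -muln2 -mulnA [2 * _]mulnC; lia.
Qed.

Lemma bit_cat x y k i :
  x < 2 ^ k -> bit (x + 2 ^ k * y) i = if i < k then bit x i else bit y (i - k).
Proof.
move=> ltxk; case: ltnP => [ltik|leki]; last first.
  rewrite -{1}(subnKC leki) -bit_shift addnC mulnC divnMDl ?expn_gt0 //.
  by rewrite divn_small // addn0.
rewrite /bit -(subnKC (ltnW ltik)) expnD -mulnA addnC mulnC divnMDl ?expn_gt0 //.
by rewrite oddD oddM oddX (negbTE (_ : k - i != 0)) ?andbF // subn_eq0 -ltnNge.
Qed.

Lemma bit_mod x k i : bit (x %% 2 ^ k) i = (i < k) && bit x i.
Proof.
have := @bit_cat (x %% 2 ^ k) (x %/ 2 ^ k) k i (ltn_pmod _ _).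
rewrite expn_gt0 mulnC addnC -divn_eq => /(_ isT) ->.
by case: ltnP => // leki; rewrite (@bit_small _ k) // ltn_pmod ?expn_gt0.
Qed.

Definition ofbits (k : nat) (f : nat -> bool) : nat := \sum_(i < k) f i * 2 ^ i.

Lemma ofbitsS k f : ofbits k.+1 f = ofbits k f + f k * 2 ^ k.
Proof. by rewrite /ofbits big_ord_recr. Qed.

Lemma ofbits_lt k f : ofbits k f < 2 ^ k.
Proof.
elim: k => [|k IH]; first by rewrite /ofbits big_ord0.
by rewrite ofbitsS expnS; case: (f k); lia.
Qed.

Lemma bit_ofbits k f j : bit (ofbits k f) j = (j < k) && f j.
Proof.
elim: k => [|k IH]; first by rewrite /ofbits big_ord0 bit0.
rewrite ofbitsS mulnC bit_cat ?ofbits_lt // IH ltnS.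
case: (ltngtP j k) => [//|ltkj|->] /=.
  have -> : j - k = (j - k).-1.+1 by lia.
  by rewrite bitS; case: (f k); rewrite bit0.
by rewrite subnn bit_zero oddb.
Qed.

Lemma ofbits_bit k x : x < 2 ^ k -> ofbits k (bit x) = x.
Proof.
move=> ltxk; apply: bit_inj => i; rewrite bit_ofbits.
by case: ltnP => // /(bit_small ltxk) ->.
Qed.

Definition len (n : nat) : nat := up_log 2 n.+1.

Lemma ltn_len n : n < 2 ^ len n.
Proof. exact: up_logP. Qed.

Lemma len_min n k : n < 2 ^ k -> len n <= k.
Proof. by move=> ltnk; apply: up_log_min. Qed.

Lemma len_snoc v j : v < 2 ^ j -> len (v + 2 ^ j) = j.+1.
Proof.
move=> ltvj; apply/eqP; rewrite eqn_leq len_min /=; last by rewrite expnS; lia.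
rewrite ltnNge; apply/negP => /(leq_pexp2l (isT : 0 < 2)).
by have := ltn_len (v + 2 ^ j); lia.
Qed.

Lemma len_half n : 0 < n -> len n = (len n./2).+1.
Proof. by move=> n_gt0; rewrite /len up_log2S. Qed.

Definition bval (l : seq bool) : nat := foldr (fun (b : bool) v => b + v.*2) 0 l.

Lemma bit_bval l i : bit (bval l) i = nth false l i.
Proof.
elim: l i => [|b l IH] [|i] //=; rewrite ?bit0 //.
  by rewrite bit_zero oddD odd_double oddb addbF.
by rewrite bitS half_bit_double IH.
Qed.

Lemma bval_lt l : bval l < 2 ^ size l.
Proof. by elim: l => //= b l IH; rewrite expnS; case: b; lia. Qed.

Lemma numeral0 : numeral 0 = [::].
Proof. by rewrite /numeral up_log1. Qed.

Lemma size_numeral a : size (numeral a) = len a.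
Proof. exact: size_mkseq. Qed.

Lemma nth_numeral a i : nth false (numeral a) i = bit a i.
Proof.
have [ltil|leli] := ltnP i (len a); first by rewrite nth_mkseq.
rewrite nth_default ?size_numeral // (@bit_small _ (len a)) //.
exact: ltn_len.
Qed.

Lemma bval_numeral a : bval (numeral a) = a.
Proof. by apply: bit_inj => i; rewrite bit_bval nth_numeral. Qed.

Lemma numeral_rec a : 0 < a -> numeral a = odd a :: numeral a./2.
Proof.
move=> a_gt0; apply: (@eq_from_nth _ false) => [|i _].
  by rewrite /= !size_numeral len_half.
by case: i => [|i] /=; rewrite nth_numeral ?bit_zero // nth_numeral bitS.
Qed.

(** The most significant bit comes last; the default [true] admits the empty list, which is the
    numeral of 0. *)
Definition canonical (l : seq bool) : bool := last true l.

Lemma canonical_numeral a : canonical (numeral a).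
Proof.
elim/ltn_ind: a => a IH; case: (posnP a) => [->|a_gt0]; first by rewrite numeral0.
rewrite numeral_rec // /canonical /=.
case: (posnP a./2) => [a2|a2].
  by rewrite a2 numeral0 /=; lia.
by have := IH a./2; rewrite /canonical numeral_rec //= => -> //; lia.
Qed.

Lemma numeral_bval l : canonical l -> numeral (bval l) = l.
Proof.
elim: l => [|b l IH]; first by rewrite numeral0.
rewrite /canonical /= => can_bl.
have bv_gt0 : 0 < b + (bval l).*2.
  case: b can_bl => //; case: l IH => // c l IH can_cl.
  have := IH can_cl; case: (posnP (bval (c :: l))) => [-> |]; last by lia.
  by rewrite numeral0.
rewrite numeral_rec //= oddD odd_double oddb addbF half_bit_double IH //.
by case: l can_bl {IH bv_gt0}.
Qed.

(** * Unmarked positions *)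

Notation ones f a b := (\sum_(a <= h < b) (f h : bool)).
Notation zeros f a b := (\sum_(a <= h < b) ~~ f h).

Definition free0 (f : nat -> bool) (i : nat) : Prop :=
  forall j, j <= i -> ones f j i.+1 < zeros f j i.+1.

Definition free1 (f : nat -> bool) (n i : nat) : Prop :=
  forall j, i <= j < n -> zeros f i j.+1 < ones f i j.+1.

(** The marked positions form a balanced bracket word in which no pair straddles an unmarked
    position. The case i = n of [matching_eq] treats the end as one more unmarked position. *)
Record matching (f : nat -> bool) (n : nat) (m : nat -> bool) : Prop := {
  matching_eq : forall i, i <= n -> (i = n) \/ ~~ m i ->
    ones (fun h => m h && f h) 0 i = ones (fun h => m h && ~~ f h) 0 i;
  matching_le : forall i, i <= n ->
    ones (fun h => m h && ~~ f h) 0 i <= ones (fun h => m h && f h) 0 i;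
  matching_sorted : forall p q, p < q < n -> ~~ m p -> ~~ m q -> f p -> f q }.

Section MatchingTheory.

Variables (f : nat -> bool) (n : nat) (m : nat -> bool).
Hypothesis mP : matching f n m.

Local Notation m1 := (fun h => m h && f h).
Local Notation m0 := (fun h => m h && ~~ f h).
Local Notation u1 := (fun h => ~~ m h && f h).
Local Notation u0 := (fun h => ~~ m h && ~~ f h).

Lemma ones_split a b : ones f a b = ones m1 a b + ones u1 a b.
Proof. by rewrite -big_split; apply: eq_bigr => h _; case: (m h); case: (f h). Qed.

Lemma zeros_split a b : zeros f a b = ones m0 a b + ones u0 a b.
Proof. by rewrite -big_split; apply: eq_bigr => h _; case: (m h); case: (f h). Qed.

Lemma sum_prefix (g : nat -> bool) a b :
  a <= b -> ones g 0 b = ones g 0 a + ones g a b.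
Proof. by move=> leab; rewrite (@big_cat_nat _ _ _ a). Qed.

(** The marked part of [0, i) is balanced and that of [0, j) has no excess of zeros, so that of [j,
    i) has no excess of ones. Sortedness excludes unmarked ones before i, and i itself makes the
    inequality strict. *)
Lemma unmarked_free0 i : i < n -> ~~ m i -> ~~ f i -> free0 f i.
Proof.
move=> ltin mi fi j leji.
have e1 := matching_eq mP (ltnW ltin) (or_intror mi).
have e2 := matching_le mP (leq_trans leji (ltnW ltin)).
have e3 := sum_prefix m1 leji; have e4 := sum_prefix m0 leji.
have u1_0 : ones u1 j i.+1 = 0.
  rewrite big_nat_cond big1 // => h /andP[/andP[lejh lthi] _].
  case mh: (m h) => //=; case fh: (f h) => //.
  move: lthi; rewrite ltnS leq_eqVlt => /orP[/eqP ehi|lthi].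
    by rewrite -ehi fh in fi.
  by rewrite (matching_sorted mP (p := h) _ _ mi fh) ?mh ?lthi // in fi.
rewrite ones_split zeros_split u1_0 !big_nat_recr //= (negbTE mi) fi /=.
by lia.
Qed.

Lemma unmarked_free1 i : i < n -> ~~ m i -> f i -> free1 f n i.
Proof.
move=> ltin mi fi j /andP[leij ltjn].
have e1 := matching_eq mP (ltnW ltin) (or_intror mi).
have e2 := matching_le mP ltjn.
have leij1 : i <= j.+1 by lia.
have e3 := sum_prefix m1 leij1; have e4 := sum_prefix m0 leij1.
have u0_0 : ones u0 i j.+1 = 0.
  rewrite big_nat_cond big1 // => h /andP[/andP[leih lthj] _].
  case mh: (m h) => //=; case fh: (f h) => //.
  move: leih; rewrite leq_eqVlt => /orP[/eqP eih|ltih].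
    by rewrite eih fh in fi.
  have lthn : i < h < n by rewrite ltih (leq_trans lthj).
  by rewrite (matching_sorted mP lthn mi _ fi) ?mh // in fh.
have u1_gt0 : 0 < ones u1 i j.+1 by rewrite big_ltn ?ltnS // mi fi.
by rewrite ones_split zeros_split; lia.
Qed.

(** Take for j the start of the maximal marked run ending just before i: it is 0 or follows an
    unmarked position, so the prefix is balanced there. *)
Lemma run_start i : i <= n ->
  exists j, [/\ j <= i, forall h, j <= h < i -> m h
    & ones m1 0 j = ones m0 0 j].
Proof.
elim: i => [|i IH] ltin; first by exists 0; rewrite !big_geq; split=> // h; lia.
have [mi|mi] := boolP (m i); last first.
  exists i.+1; split=> // [h|]; first by lia.
  by rewrite !big_nat_recr //= (negbTE mi) (matching_eq mP (ltnW ltin)) //; right.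
have [j [leji mj ej]] := IH (ltnW ltin).
exists j; split=> // [|h /andP[lejh]]; first by lia.
by rewrite ltnS leq_eqVlt => /orP[/eqP-> //|lthi]; apply: mj; lia.
Qed.

Lemma run_end i : i <= n ->
  exists j, [/\ i <= j <= n, forall h, i <= h < j -> m h
    & ones m1 0 j = ones m0 0 j].
Proof.
move=> lein; have [k] := ubnP (n - i); elim: k i lein => // k IH i lein ltk.
have [eqin|ltin] := eqVneq i n.
  exists i; rewrite lein leqnn; split=> // [h|]; first by lia.
  by apply: (matching_eq mP) => //; left.
have [mi|mi] := boolP (m i); last first.
  exists i; rewrite lein leqnn; split=> // [h|]; first by lia.
  by apply: (matching_eq mP) => //; right.
have [||j [leij mj ej]] := IH i.+1; try lia.
exists j; split=> // [|h /andP[leih lthj]]; first by lia.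
by move: leih; rewrite leq_eqVlt => /orP[/eqP <- //|ltih]; apply: mj; lia.
Qed.

(** From the start j of the run up to i every position is marked. The prefix is balanced at j and
    has no excess of zeros after i, so [j, i] violates [free0]. *)
Lemma marked_free0 i : i < n -> m i -> ~~ f i -> ~ free0 f i.
Proof.
move=> ltin mi fi fr.
have [j [leji mj ej]] := run_start (ltnW ltin).
have := fr j leji; have := matching_le mP ltin.
have leji1 : j <= i.+1 by lia.
have e3 := sum_prefix m1 leji1; have e4 := sum_prefix m0 leji1.
have u0_0 : ones u0 j i.+1 = 0.
  rewrite big_nat_cond big1 // => h /andP[/andP[lejh lthi] _].
  have -> // : m h by move: lthi; rewrite ltnS leq_eqVlt => /orP[/eqP-> //|?]; apply: mj; lia.
by rewrite ones_split zeros_split; lia.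
Qed.

Lemma marked_free1 i : i < n -> m i -> f i -> ~ free1 f n i.
Proof.
move=> ltin mi fi fr.
have [j [/andP[ltij lejn] mj ej]] := run_end ltin.
have := fr j.-1; rewrite prednK ?(leq_trans _ ltij) // => /(_ _) fr'.
have {}fr' : zeros f i j < ones f i j by apply: fr'; lia.
have := matching_le mP (ltnW ltin).
have e3 := sum_prefix m1 (ltnW ltij); have e4 := sum_prefix m0 (ltnW ltij).
have u1_0 : ones u1 i j = 0.
  rewrite big_nat_cond big1 // => h /andP[/andP[leih lthj] _].
  have -> // : m h by move: leih; rewrite leq_eqVlt => /orP[/eqP <- //|?]; apply: mj; lia.
by move: fr'; rewrite ones_split zeros_split; lia.
Qed.

Lemma free0P i : i < n -> (~~ m i && ~~ f i) <-> (~~ f i /\ free0 f i).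
Proof.
move=> ltin; split=> [/andP[mi fi]|[fi fr]]; first by split=> //; apply: unmarked_free0.
by rewrite fi andbT; apply/negP => mi; apply: marked_free0 fr.
Qed.

Lemma free1P i : i < n -> (~~ m i && f i) <-> (f i /\ free1 f n i).
Proof.
move=> ltin; split=> [/andP[mi fi]|[fi fr]]; first by split=> //; apply: unmarked_free1.
by rewrite fi andbT; apply/negP => mi; apply: marked_free1 fr.
Qed.

End MatchingTheory.

(** Being unmarked is equivalent to [free0] for a 0 and to [free1] for a 1, and these mention only
    f. *)
Lemma matching_unique f n m m' :
  matching f n m -> matching f n m' -> forall i, i < n -> m i = m' i.
Proof.
move=> mP mP' i ltin; apply: negb_inj; apply/idP/idP => mi.
  case fi: (f i).
    have /(free1P mP ltin)/(free1P mP' ltin) : ~~ m i && f i by rewrite mi fi.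
    by case/andP.
  have /(free0P mP ltin)/(free0P mP' ltin) : ~~ m i && ~~ f i by rewrite mi fi.
  by case/andP.
case fi: (f i).
  have /(free1P mP' ltin)/(free1P mP ltin) : ~~ m' i && f i by rewrite mi fi.
  by case/andP.
have /(free0P mP' ltin)/(free0P mP ltin) : ~~ m' i && ~~ f i by rewrite mi fi.
by case/andP.
Qed.

(* Only the values on the marked positions enter the balance conditions. *)
Lemma matching_transfer f g n m :
  matching f n m -> (forall i, i < n -> m i -> g i = f i) ->
  (forall p q, p < q < n -> ~~ m p -> ~~ m q -> g p -> g q) -> matching g n m.
Proof.
move=> mP eqfg sorted_g.
have e1 i : i <= n -> ones (fun h => m h && g h) 0 i = ones (fun h => m h && f h) 0 i.
  move=> lein; apply: eq_big_nat => h /andP[_ lthi].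
  by case mh: (m h) => //=; rewrite eqfg //; lia.
have e0 i : i <= n ->
    ones (fun h => m h && ~~ g h) 0 i = ones (fun h => m h && ~~ f h) 0 i.
  move=> lein; apply: eq_big_nat => h /andP[_ lthi].
  by case mh: (m h) => //=; rewrite eqfg //; lia.
by split=> // i lein; rewrite e1 // e0 //; [apply: (matching_eq mP)|apply: (matching_le mP)].
Qed.

(** * The marking process ends in a matching *)

Section Process.

Variables (n : nat) (x : n.-tuple bool).
Implicit Types M : {set 'I_n}.

Let ones_in M i := \sum_(h in M) ((h < i) && tnth x h : nat).
Let zeros_in M i := \sum_(h in M) ((h < i) && ~~ tnth x h : nat).

Let balanced M :=
  (forall i : nat, (i = n) \/ (exists2 h : 'I_n, i = h & h \notin M) ->
     ones_in M i = zeros_in M i)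
  /\ forall i, zeros_in M i <= ones_in M i.

Lemma balanced_add M p q :
  balanced M -> markable x M (p, q) -> balanced (p |: (q |: M)).
Proof.
move=> [balM geM] /and5P[/= ltpq pM qM /forallP allM /andP[xp xq]].
have e1 i : ones_in (p |: (q |: M)) i = (p < i) + ones_in M i.
  rewrite /ones_in big_setU1 /=; last by rewrite !inE negb_or pM neq_ltn ltpq.
  by rewrite big_setU1 //= xp (negbTE xq) andbT andbF.
have e0 i : zeros_in (p |: (q |: M)) i = (q < i) + zeros_in M i.
  rewrite /zeros_in big_setU1 /=; last by rewrite !inE negb_or pM neq_ltn ltpq.
  by rewrite big_setU1 //= xp xq andbT andbF.
split=> i; rewrite e1 e0; last by have := geM i; lia.
case=> [->|[h -> hM]]; first by rewrite !ltn_ord balM //; left.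
rewrite balM; last first.
  by right; exists h => //; apply: contra hM; rewrite !inE => ->; rewrite !orbT.
(* All positions strictly between p and q are already marked, so the unmarked h has both p and q on
   its left or neither. *)
have := allM h; move: hM; rewrite !inE !negb_or => /and3P[hp hq /negbTE->].
by rewrite implybF -!val_eqE /= in hp hq *; lia.
Qed.

(** Descent on q - p: an unmarked position between them replaces p if it carries 1 and q if it
    carries 0. *)
Lemma markable_exists M (p q : 'I_n) :
  p < q -> p \notin M -> q \notin M -> tnth x p -> ~~ tnth x q ->
  exists pq, markable x M pq.
Proof.
have [k] := ubnP (q - p); elim: k p q => // k IH p q ltk ltpq pM qM xp xq.
have [all_M|] := boolP [forall r : 'I_n, (p < r < q) ==> (r \in M)].
  by exists (p, q); rewrite /markable /= ltpq pM qM all_M xp xq.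
rewrite negb_forall => /existsP[r]; rewrite negb_imply => /andP[/andP[ltpr ltrq] rM].
case xr: (tnth x r); first by apply: (IH r q) => //; lia.
by apply: (IH p r) => //; rewrite ?xr //; lia.
Qed.

(** Either every step so far has marked two positions or the process is stuck. At k = n the first
    alternative fails as soon as some position is unmarked. *)
Lemma iter_mark_step k :
  let M := iter k (mark_step x) set0 in
  balanced M /\ (k.*2 <= #|M| \/ forall pq, ~~ markable x M pq).
Proof.
elim: k => [|k [balM sizeM]] /=.
  split; last by left; rewrite cards0.
  split=> i; last by rewrite /zeros_in big_set0.
  by rewrite /ones_in /zeros_in !big_set0.
set M := iter k _ _ in balM sizeM *.
rewrite /mark_step; case: pickP => [[p q] pqP|nomark]; last first.
  by split=> //; right=> pq; rewrite nomark.
split; first exact: balanced_add.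
left; case: sizeM => [|/(_ (p, q))]; last by rewrite pqP.
case/and5P: pqP => /= ltpq pM qM _ _.
rewrite !cardsU1 !inE negb_or pM qM neq_ltn ltpq /=; lia.
Qed.

Definition is_marked (i : nat) : bool := [exists h in marked x, i == h :> nat].

Lemma is_markedE (h : 'I_n) : is_marked h = (h \in marked x).
Proof.
apply/exists_inP/idP => [[k kM /eqP/val_inj->] //|hM].
by exists h.
Qed.

Lemma nth_ord (h : 'I_n) : nth false x h = tnth x h.
Proof. by rewrite (tnth_nth false). Qed.

Lemma sum_marked (g : nat -> bool) i : i <= n ->
  ones (fun h => is_marked h && g h) 0 i
  = \sum_(h in marked x) ((h < i) && g h : nat).
Proof.
move=> lein; rewrite (big_nat_widen _ _ n) // big_mkord [RHS]big_mkcond [LHS]big_mkcond.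
by apply: eq_bigr => h _; rewrite is_markedE; case: (h \in _); case: (h < i).
Qed.

Lemma marked_matching : matching (nth false x) n is_marked.
Proof.
have [[balM geM] sizeM] := iter_mark_step n; rewrite -/(marked x) in balM geM sizeM.
have e1 i : i <= n -> ones (fun h => is_marked h && nth false x h) 0 i = ones_in (marked x) i.
  by move=> lein; rewrite sum_marked //; apply: eq_bigr => h _; rewrite nth_ord.
have e0 i : i <= n -> ones (fun h => is_marked h && ~~ nth false x h) 0 i = zeros_in (marked x) i.
  by move=> lein; rewrite sum_marked //; apply: eq_bigr => h _; rewrite nth_ord.
split=> [i lein|i lein|p q /andP[ltpq ltqn]].
- rewrite e1 // e0 // => iM; apply: balM; case: iM => [|iM]; first by left.
  move: lein; rewrite leq_eqVlt => /orP[/eqP|ltin]; first by left.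
  by right; exists (Ordinal ltin) => //; rewrite -is_markedE.
- by rewrite e1 // e0.
have ltpn := ltn_trans ltpq ltqn.
rewrite -[p]/(val (Ordinal ltpn)) -[q]/(val (Ordinal ltqn)) !is_markedE !nth_ord.
move=> pM qM xp; apply/negPn/negP => xq.
have [pq pqP] := markable_exists (ltpq : Ordinal ltpn < Ordinal ltqn) pM qM xp xq.
case: sizeM => [size_ge|/(_ pq)]; last by rewrite pqP.
have: #|marked x| < n.
  rewrite -[n in _ < n]card_ord -cardsT; apply: proper_card.
  by rewrite properT; apply/eqP => eqT; rewrite eqT inE in pM.
by lia.
Qed.

End Process.

Lemma count_rank (m : nat -> bool) c n :
  ones (fun h => ~~ m h && (zeros m 0 h < c)) 0 n = minn c (zeros m 0 n).
Proof.
elim: n => [|n IH]; first by rewrite !big_geq // minn0.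
by rewrite !big_nat_recr //= IH; case: (m n) => /=; lia.
Qed.

Lemma nth_rcons_tuple n (t : n.-tuple bool) b i :
  nth false [tuple of rcons t b] i = if i < n then nth false t i else (i == n) && b.
Proof. by rewrite /= nth_rcons size_tuple; case: ltngtP. Qed.

(** * The map psi as a relabelling of the unmarked positions *)

Section PsiFormula.

Variables (n : nat) (x : n.-tuple bool).

Local Notation f := (nth false x).
Local Notation m := (is_marked x).
Local Notation rank := (fun i => zeros m 0 i).
Local Notation u0 := (fun h => ~~ m h && ~~ f h).
Local Notation z := (ones u0 0 n).

Lemma sorted_rank i : i < n -> ~~ m i -> f i = (z <= rank i).
Proof.
move=> ltin mi; have mP := marked_matching x.
have ez : z = ones u0 0 i + ones u0 i n by rewrite (@big_cat_nat _ _ _ i) //; lia.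
case fi: (f i).
  have : ones u0 i n = 0.
    rewrite big_nat_cond big1 // => h /andP[/andP[leih lthn] _].
    case mh: (m h) => //=; case fh: (f h) => //.
    move: leih; rewrite leq_eqVlt => /orP[/eqP eih|ltih]; first by rewrite -eih fi in fh.
    by rewrite (matching_sorted mP (p := i) (q := h)) ?mh ?ltih in fh.
  have : ones u0 0 i <= rank i.
    by apply: leq_sum => h _; case: (m h); case: (f h).
  by rewrite ez; lia.
have : rank i = ones u0 0 i.
  apply: eq_big_nat => h /andP[_ lthi]; case mh: (m h) => //=; case fh: (f h) => //.
  move: (matching_sorted mP (p := h) (q := i)).
  by rewrite lthi ltin mh mi fh fi => /(_ isT isT isT isT).
have : 0 < ones u0 i n by rewrite big_ltn // mi fi.
by rewrite ez; lia.
Qed.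

Lemma card_unmarked_lt i : i <= n -> #|[set u in unmarked x | u < i]| = rank i.
Proof.
move=> lein; rewrite /= (big_nat_widen _ _ n) // big_mkord -sum1_card.
rewrite [LHS]big_mkcond [RHS]big_mkcond /=; apply: eq_bigr => h _.
by rewrite !inE is_markedE; case: (h \in _); case: (h < i).
Qed.

Lemma card_unmarked : #|unmarked x| = rank n.
Proof.
transitivity #|[set u in unmarked x | u < n]|; last exact: card_unmarked_lt.
by apply: eq_card => u; rewrite !inE ltn_ord andbT.
Qed.

Lemma chain_min_double : n = (chain_min x).*2 + rank n.
Proof.
have eqM := matching_eq (marked_matching x) (leqnn n) (or_introl erefl).
have : n = ones (fun h => m h && f h) 0 n + ones (fun h => m h && ~~ f h) 0 n + rank n.
  rewrite -!big_split /= -[LHS]subn0 -[LHS]muln1 -sum_nat_const_nat.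
  by apply: eq_bigr => h _; case: (m h); case: (f h).
by rewrite /chain_min card_unmarked eqM; lia.
Qed.

Lemma nth_chain a i : i < n ->
  nth false (chain x (chain_min x + a)) i
  = if m i then f i else rank n - a <= rank i.
Proof.
move=> ltin; rewrite -[i]/(val (Ordinal ltin)) nth_ord tnth_mktuple.
by rewrite card_unmarked card_unmarked_lt ?addKn -?is_markedE -?nth_ord // ltnW.
Qed.

Lemma zeros_le : z <= rank n.
Proof. by apply: leq_sum => h _; case: (m h); case: (f h). Qed.

Lemma eq_tupleP (T : Type) k (s t : k.-tuple T) x0 :
  (forall i, i < k -> nth x0 s i = nth x0 t i) -> s = t.
Proof. by move=> e; apply/val_inj/(@eq_from_nth _ x0); rewrite !size_tuple. Qed.

Lemma chain_indexE : chain_index x = chain_min x + (rank n - z).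
Proof.
congr (_ + _); rewrite card_unmarked; set s := map _ _.
have sz_s : size s = (rank n).+1 by rewrite size_map size_iota.
have lt_s : rank n - z < size s by rewrite sz_s; lia.
have nth_s a : a < size s -> nth x s a = chain x (chain_min x + a).
  by rewrite sz_s => lta; rewrite (nth_map 0) ?size_iota // nth_iota.
transitivity (index (nth x s (rank n - z)) s).
  congr index.
  rewrite nth_s //; apply: (@eq_tupleP _ _ _ _ false) => i ltin.
  rewrite nth_chain // subKn ?zeros_le //.
  by have [//|mi] := boolP (m i); apply: sorted_rank.
(* [index] returns the first occurrence, so the chain must be free of repetitions: its members
   differ in their numbers of unmarked zeros. *)
rewrite index_uniq //; apply/(uniqP x) => a b; rewrite !inE => lta ltb.
rewrite !nth_s //.
move/(congr1 (fun t : n.-tuple bool => ones (fun h => ~~ m h && ~~ nth false t h) 0 n)).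
have cnt c : c < size s ->
  ones (fun h => ~~ m h && ~~ nth false (chain x (chain_min x + c)) h) 0 n = rank n - c.
  move=> ltc; transitivity (ones (fun h => ~~ m h && (rank h < rank n - c)) 0 n).
    apply: eq_big_nat => h /andP[_ lthn]; rewrite nth_chain //.
    by case: (m h); rewrite //= ltnNge.
  by rewrite count_rank; apply/minn_idPl/leq_subr.
by rewrite !cnt //; move: lta ltb; rewrite sz_s; have := zeros_le; lia.
Qed.

(** Both branches follow one rule: the number z of unmarked zeros is halved, rounding down, and the
    last bit keeps the lost parity. *)
Lemma psiE : psi x =
  [tuple of rcons (chain x (chain_min x + (rank n - z./2))) (~~ odd z)].
Proof.
have en := chain_min_double; have zle := zeros_le.
have eM : chain_max x = chain_min x + rank n by rewrite /chain_max; lia.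
rewrite /psi chain_indexE eM.
case: eqP => par.
  have -> : (chain_min x + rank n + (chain_min x + (rank n - z)))./2
            = chain_min x + (rank n - z./2) by lia.
  by congr [tuple of rcons _ _]; lia.
have -> : (chain_min x + rank n + (chain_min x + (rank n - z))).+1./2
          = chain_min x + (rank n - z./2) by lia.
by congr [tuple of rcons _ _]; lia.
Qed.

Lemma nth_psi i : i < n ->
  nth false (psi x) i = if m i then f i else z./2 <= rank i.
Proof.
move=> ltin; rewrite psiE nth_rcons_tuple ltin nth_chain //.
by rewrite subKn //; have := zeros_le; lia.
Qed.

Lemma nth_psi_last : nth false (psi x) n = ~~ odd z.
Proof. by rewrite psiE nth_rcons_tuple ltnn eqxx. Qed.

End PsiFormula.

Notation unmarked_zeros x n :=
  (ones (fun h => ~~ is_marked x h && ~~ nth false x h) 0 n).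

Section Relabel.

(* [t] is obtained from [s] by relabelling the unmarked positions so that the
   first [c] of them carry 0. *)
Variables (n : nat) (s t : n.-tuple bool) (c : nat).
Hypothesis nth_t : forall i, i < n ->
  nth false t i = if is_marked s i then nth false s i
                  else c <= zeros (is_marked s) 0 i.

(** The marks of s are a [matching] for t too: the marked values are unchanged, and a threshold on
    the rank keeps the unmarked ones sorted. *)
Lemma relabel_marked i : i < n -> is_marked t i = is_marked s i.
Proof.
apply: (matching_unique (marked_matching t)).
apply: matching_transfer (marked_matching s) _ _ => [h lthn mh|p q /andP[ltpq ltqn] mp mq].
  by rewrite nth_t ?mh.
rewrite !nth_t ?(ltn_trans ltpq) // (negbTE mp) (negbTE mq) => lec.
by apply: leq_trans lec _; rewrite [leqRHS](@big_cat_nat _ _ _ p) ?leq_addr //; lia.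
Qed.

Lemma relabel_rank i : i <= n -> zeros (is_marked t) 0 i = zeros (is_marked s) 0 i.
Proof.
by move=> lein; apply: eq_big_nat => h /andP[_ lthi]; rewrite relabel_marked //; lia.
Qed.

Lemma relabel_zeros : unmarked_zeros t n = minn c (zeros (is_marked s) 0 n).
Proof.
rewrite -count_rank; apply: eq_big_nat => h /andP[_ lthn].
by rewrite relabel_marked // nth_t //; case: (is_marked s h); rewrite //= ltnNge.
Qed.

End Relabel.

(** * The inverse map *)

Section PsiInverse.

Variables (n : nat) (y : n.+1.-tuple bool).

Definition init_tuple : n.-tuple bool := [tuple nth false y i | i < n].

Local Notation w := init_tuple.
Local Notation b := (nth false y n).
Local Notation rank i := (zeros (is_marked w) 0 i).
Local Notation z := (unmarked_zeros w n).

Lemma nth_init_tuple i : i < n -> nth false w i = nth false y i.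
Proof. by move=> ltin; rewrite -[i]/(val (Ordinal ltin)) nth_ord tnth_mktuple. Qed.

Definition unpsi : n.-tuple bool :=
  [tuple if is_marked w i then nth false w i else z.*2 + ~~ b <= rank i | i < n].

Lemma nth_unpsi i : i < n ->
  nth false unpsi i = if is_marked w i then nth false w i else z.*2 + ~~ b <= rank i.
Proof.
move=> ltin; rewrite -[nth _ _ i]/(nth _ _ (val (Ordinal ltin))).
by rewrite nth_ord tnth_mktuple.
Qed.

Lemma psi_cancel x : psi x = y -> x = unpsi.
Proof.
move=> psi_x; apply: (@eq_tupleP _ _ _ _ false) => i ltin.
have nth_w j : j < n -> nth false w j = if is_marked x j then nth false x j
    else (unmarked_zeros x n)./2 <= zeros (is_marked x) 0 j.
  by move=> ltjn; rewrite nth_init_tuple // -psi_x nth_psi.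
have eb : b = ~~ odd (unmarked_zeros x n) by rewrite -psi_x nth_psi_last.
have ez : z = (unmarked_zeros x n)./2.
  by rewrite (relabel_zeros nth_w); apply/minn_idPl; have := zeros_le x; lia.
rewrite nth_unpsi // (relabel_marked nth_w) // nth_w //.
case mi: (is_marked x i) => //; rewrite (relabel_rank nth_w) ?(ltnW ltin) //.
rewrite sorted_rank ?mi // ez eb negbK.
by congr (_ <= _); rewrite addnC odd_double_half.
Qed.

Lemma psi_unpsi : ~~ odd n -> y \in heavy n -> psi unpsi = y.
Proof.
move=> n_even; rewrite inE => y_heavy.
have en := chain_min_double w; have zle := zeros_le w.
have eq_y : nth false y =1 nth false (rcons w b).
  move=> i; rewrite nth_rcons size_tuple; case: (ltngtP i n) => [ltin|ltni|->//].
    by rewrite nth_init_tuple.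
  by rewrite nth_default // size_tuple.
have y_weight : weight y = weight w + b.
  transitivity (count id (rcons w b)).
    congr count; apply: (@eq_from_nth _ false) => [|i _]; last exact: eq_y.
    by rewrite size_rcons !size_tuple.
  by rewrite -cats1 count_cat /= addn0.
have w_weight : weight w = chain_min w + (rank n - z).
  have -> : weight w = ones (nth false w) 0 n.
    rewrite /weight -sum1_count (big_nth false) size_tuple big_mkcond.
    by apply: eq_bigr => h _; case: (nth _ _ _).
  have eqM := matching_eq (marked_matching w) (leqnn n) (or_introl erefl).
  have e1 : n = ones (nth false w) 0 n + zeros (nth false w) 0 n.
    rewrite -big_split /= -[LHS]subn0 -[LHS]muln1 -sum_nat_const_nat.
    by apply: eq_bigr => h _; case: (nth _ _ _).
  rewrite (ones_split _ (is_marked w)) (zeros_split _ (is_marked w)) eqM in e1 *.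
  have : rank n = ones (fun h => ~~ is_marked w h && nth false w h) 0 n + z.
    by rewrite -big_split; apply: eq_bigr => h _; case: (is_marked w h); case: (nth _ _ _).
  by lia.
(* As n = 2 * chain_min w + rank n, heaviness reads 2 * z < rank n + 2 * b. Since rank n is even,
   there is room for 2 * z + ~~ b unmarked zeros. *)
have le_c : z.*2 + ~~ b <= rank n.
  have : ~~ odd (rank n) by lia.
  by rewrite y_weight w_weight in y_heavy; move: y_heavy; case: b; lia.
have zE : unmarked_zeros unpsi n = z.*2 + ~~ b.
  by rewrite (relabel_zeros nth_unpsi); apply/minn_idPl.
apply: (@eq_tupleP _ _ _ _ false) => i; rewrite ltnS leq_eqVlt => /orP[/eqP->|ltin].
  by rewrite nth_psi_last zE oddD odd_double /= oddb negbK.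
rewrite nth_psi // (relabel_marked nth_unpsi) // (relabel_rank nth_unpsi) ?(ltnW ltin) //.
rewrite zE nth_unpsi // -(nth_init_tuple ltin); case mi: (is_marked w i) => //.
have -> : (z.*2 + ~~ b)./2 = z by case: b; lia.
by rewrite (sorted_rank (x := w)) ?mi.
Qed.

Lemma psi_invE : ~~ odd n -> y \in heavy n -> psi_inv y = unpsi.
Proof.
move=> n_even y_heavy; rewrite /psi_inv; case: pickP => [x /eqP|/(_ unpsi)].
  exact: psi_cancel.
by rewrite psi_unpsi ?eqxx.
Qed.

End PsiInverse.

(** * Both maps expressed by comparisons of counts of free positions *)

Definition free0b (f : nat -> bool) (i : nat) : bool :=
  all (fun j => ones f j i.+1 < zeros f j i.+1) (iota 0 i.+1).

Definition free1b (f : nat -> bool) (n i : nat) : bool :=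
  all (fun j => zeros f i j.+1 < ones f i j.+1) (iota i (n - i)).

Arguments free0b : simpl never.
Arguments free1b : simpl never.

Lemma free0bP f i : reflect (free0 f i) (free0b f i).
Proof.
apply: (iffP allP) => fr j.
  by move=> leji; apply: fr; rewrite mem_iota; lia.
by rewrite mem_iota => lej; apply: fr; lia.
Qed.

Lemma free1bP f n i : i <= n -> reflect (free1 f n i) (free1b f n i).
Proof.
move=> lein; apply: (iffP allP) => fr j.
  by move=> leij; apply: fr; rewrite mem_iota; lia.
by rewrite mem_iota => leij; apply: fr; lia.
Qed.

Section Formulas.

Variables (n : nat) (x : n.-tuple bool).

Local Notation f := (nth false x).
Local Notation m := (is_marked x).
Local Notation rank i := (zeros m 0 i).

Lemma free0bE i : i < n -> free0b f i = ~~ m i && ~~ f i.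
Proof.
move=> ltin; apply/free0bP/idP => [fr|/(free0P (marked_matching x) ltin)[] //].
apply/(free0P (marked_matching x) ltin); split=> //.
by have := fr i (leqnn i); rewrite !big_nat1; case: (f i).
Qed.

Lemma free1bE i : i < n -> free1b f n i = ~~ m i && f i.
Proof.
move=> ltin; apply/(free1bP _ (ltnW ltin))/idP => [fr|/(free1P (marked_matching x) ltin)[] //].
apply/(free1P (marked_matching x) ltin); split=> //.
have := fr i; rewrite leqnn ltin => /(_ isT).
by rewrite !big_nat1; case: (f i).
Qed.

Lemma unmarked_zerosE : unmarked_zeros x n = ones (free0b f) 0 n.
Proof. by apply: eq_big_nat => h /andP[_ lthn]; rewrite free0bE. Qed.

Lemma rank_split i : i <= n -> rank i = ones (free0b f) 0 i + ones (free1b f n) 0 i.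
Proof.
move=> lein; rewrite -big_split; apply: eq_big_nat => h /andP[_ lthi].
by rewrite free0bE ?free1bE ?(leq_trans lthi) //; case: (m h); case: (f h).
Qed.

Lemma free01_sorted p q : p < q < n -> free1b f n p -> ~~ free0b f q.
Proof.
move=> /andP[ltpq ltqn]; rewrite free1bE ?(ltn_trans ltpq) // free0bE // => /andP[mp fp].
case mq: (m q) => //=; rewrite negbK.
by apply: (matching_sorted (marked_matching x) (p := p)); rewrite ?ltpq ?mq.
Qed.

Lemma rank_free0 i : i < n -> free0b f i -> rank i = ones (free0b f) 0 i.
Proof.
move=> ltin fr; rewrite (rank_split (ltnW ltin)) [X in _ + X]big_nat_cond.
rewrite [X in _ + X]big1 ?addn0 // => h /andP[/andP[_ lthi] _].
by case fr1: (free1b f n h) => //; move: fr; rewrite (negbTE (free01_sorted _ fr1)) // lthi.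
Qed.

Lemma rank_free1 i : i < n -> free1b f n i ->
  rank i = ones (free0b f) 0 n + ones (free1b f n) 0 i.
Proof.
move=> ltin fr; rewrite (rank_split (ltnW ltin)) [in RHS](@big_cat_nat _ _ _ i) //=; last lia.
rewrite [X in _ = _ + X + _]big_nat_cond [X in _ = _ + X + _]big1 ?addn0 //.
move=> h /andP[/andP[leih lthn] _]; move: leih; rewrite leq_eqVlt => /orP[/eqP <-|ltih].
  by move: fr; rewrite free0bE // free1bE //; case: (m i); case: (f i).
by rewrite (negbTE (free01_sorted _ fr)) // ltih.
Qed.

Lemma sum_at (g : nat -> bool) i : i < n -> ones g 0 n = ones g 0 i + g i + ones g i.+1 n.
Proof.
by move=> ltin; rewrite (@big_cat_nat _ _ _ i.+1) //= big_nat_recr.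
Qed.

(** An unmarked zero with a unmarked zeros before it becomes 1 iff z./2 <= a, that is z < 2 * (a +
    1): fewer unmarked zeros follow it than occur up to and including it. *)
Lemma nth_psi_free i : i < n ->
  nth false (psi x) i =
  f i || free0b f i && (ones (free0b f) i.+1 n < ones (free0b f) 0 i.+1).
Proof.
move=> ltin; rewrite nth_psi //.
have [fr|fr] := boolP (free0b f i); last first.
  rewrite orbF; case mi: (m i) => //; move: fr; rewrite free0bE // mi /=.
  by rewrite negbK => fi; have := @sorted_rank _ x _ ltin; rewrite mi fi => /(_ isT); lia.
have := rank_free0 ltin fr; have := sum_at (free0b f) ltin; rewrite -unmarked_zerosE.
move: (fr); rewrite free0bE // => /andP[/negbTE-> /negbTE->] /=.
rewrite big_nat_recr //= fr; lia.
Qed.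

(** z is odd iff some unmarked zero is the middle one, with as many before it as after it. The two
    strict comparisons express this equality, so parity needs no gate of its own. *)
Lemma psi_last_free :
  nth false (psi x) n =
  ~~ has (fun i => [&& free0b f i, ones (free0b f) i.+1 n < ones (free0b f) 0 i.+1
                     & ones (free0b f) 0 i < ones (free0b f) i n]) (iota 0 n).
Proof.
rewrite nth_psi_last unmarked_zerosE; congr (~~ _); apply/idP/hasP; last first.
  case=> i; rewrite mem_iota add0n => /andP[_ ltin] /and3P[fr].
  rewrite (sum_at (free0b f) ltin) big_nat_recr //= [\sum_(i <= h < n) _]big_ltn // fr; lia.
set F := free0b f => odd_z.
have mid k : k < ones F 0 n -> exists i, [/\ i < n, F i & ones F 0 i = k].
  elim: n => [|N IH]; first by rewrite big_geq.
  rewrite big_nat_recr //= => ltk; case: (ltnP k (ones F 0 N)) => [/IH[i [ltiN Fi ei]]|lek].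
    by exists i; split=> //; lia.
  by exists N; move: ltk lek; case FN: (F N); split=> //; lia.
have [|i [ltin Fi ei]] := mid (ones F 0 n)./2; first by lia.
exists i; first by rewrite mem_iota.
have := sum_at F ltin; rewrite Fi big_nat_recr //= [\sum_(i <= h < n) _]big_ltn // Fi; lia.
Qed.

End Formulas.

(** All z unmarked zeros precede an unmarked one, so its rank is z plus the number of unmarked ones
    before it; subtracting z from the threshold 2 * z + ~~ b leaves z + ~~ b. *)
Lemma nth_unpsi_free n (y : n.+1.-tuple bool) i : i < n ->
  nth false (unpsi y) i =
  nth false y i && ~~ (free1b (nth false y) n i &&
    (ones (free1b (nth false y) n) 0 i < ones (free0b (nth false y)) 0 n + ~~ nth false y n)).
Proof.
move=> ltin; rewrite nth_unpsi //; set w := init_tuple y.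
have eq_w j : j < n -> nth false w j = nth false y j by exact: nth_init_tuple.
have eq1 j : j < n -> free1b (nth false y) n j = free1b (nth false w) n j.
  move=> ltjn; apply: eq_in_all => h; rewrite mem_iota => hP; congr (_ < _).
    by apply: eq_big_nat => k kP; rewrite eq_w //; lia.
  by apply: eq_big_nat => k kP; rewrite eq_w //; lia.
have eq0 j : j < n -> free0b (nth false y) j = free0b (nth false w) j.
  move=> ltjn; apply: eq_in_all => h; rewrite mem_iota => hP; congr (_ < _).
    by apply: eq_big_nat => k kP; rewrite eq_w //; lia.
  by apply: eq_big_nat => k kP; rewrite eq_w //; lia.
rewrite eq1 // -(eq_w i ltin).
rewrite (_ : ones (free0b (nth false y)) 0 n = ones (free0b (nth false w)) 0 n); last first.
  by apply: eq_big_nat => k kP; rewrite eq0 //; lia.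
rewrite (_ : ones (free1b (nth false y) n) 0 i = ones (free1b (nth false w) n) 0 i); last first.
  by apply: eq_big_nat => k kP; rewrite eq1 //; lia.
rewrite unmarked_zerosE.
have [fr|fr] := boolP (free1b (nth false w) n i).
  have := rank_free1 ltin fr.
  by move: fr; rewrite free1bE // => /andP[/negbTE-> ->] /= ->; case: (nth _ y n) => /=; lia.
rewrite andbT; case mi: (is_marked w i) => //; move: fr; rewrite free1bE // mi /=.
move=> wi; rewrite (negbTE wi); have : free0b (nth false w) i by rewrite free0bE // mi wi.
move=> fr; rewrite (rank_free0 ltin fr); apply/negbTE; rewrite -ltnNge.
by rewrite (sum_at (free0b (nth false w)) ltin) fr; lia.
Qed.

(** * Families of circuits defined by comparisons *)

Definition tag (a : nat) : nat := a %% 16.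

(** As a < 2 ^ a, the bound a cuts nothing off; fields thus make sense without the length parameter
    of [pack]. *)
Definition field (a : nat) (c : bool) : nat :=
  ofbits a (fun j => bit a (4 + (j.*2 + c))).

Definition pack (L t f1 f2 : nat) : nat :=
  t + 2 ^ 4 * ofbits L.*2 (fun j => bit (if odd j then f2 else f1) j./2).

Lemma bit_field a c j : bit (field a c) j = bit a (4 + (j.*2 + c)).
Proof.
rewrite bit_ofbits; case: ltnP => //= leaj.
by rewrite (@bit_small _ a) //; [apply: ltn_expl | lia].
Qed.

Lemma gate_bound L : 16 * 4 ^ L = 2 ^ (4 + L.*2).
Proof. by rewrite expnD -mul2n expnM. Qed.

Lemma tag_lt a : tag a < 16. Proof. exact: ltn_pmod. Qed.

Lemma tag_pack L t f1 f2 : t < 16 -> tag (pack L t f1 f2) = t.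
Proof. by move=> lt_t; rewrite /tag /pack addnC mulnC modnMDl modn_small. Qed.

Lemma pack_lt L t f1 f2 : t < 16 -> pack L t f1 f2 < 16 * 4 ^ L.
Proof.
move=> lt_t; rewrite gate_bound expnD /pack.
by have := ofbits_lt L.*2 (fun j => bit (if odd j then f2 else f1) j./2); lia.
Qed.

Lemma field_pack L t f1 f2 c : t < 16 -> f1 < 2 ^ L -> f2 < 2 ^ L ->
  field (pack L t f1 f2) c = if c then f2 else f1.
Proof.
move=> lt_t lt1 lt2; apply: bit_inj => j; rewrite bit_field bit_cat //.
rewrite ltnNge leq_addr /= addKn bit_ofbits.
rewrite oddD odd_double oddb /= addnC half_bit_double.
case: ltnP => /= [_|le_L]; first by case: c.
by rewrite (@bit_small _ L) //; case: c le_L => //; lia.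
Qed.

Lemma field_lt L a c : a < 16 * 4 ^ L -> field a c < 2 ^ L.
Proof.
move=> lt_a; apply: bit_small_ltn => j leLj; rewrite bit_field.
rewrite (@bit_small _ (4 + L.*2)) //; last by lia.
by rewrite -gate_bound.
Qed.

Lemma packK L a : a < 16 * 4 ^ L ->
  pack L (tag a) (field a false) (field a true) = a.
Proof.
move=> lt_a; have lt_a' := lt_a; rewrite gate_bound in lt_a'.
apply: bit_inj => i; rewrite /pack bit_cat ?tag_lt // (bit_mod a 4).
case: ltnP => //= le4i; rewrite bit_ofbits.
have [ltiL|leLi] /= := ltnP (i - 4) L.*2; last by rewrite (bit_small lt_a') //; lia.
have -> : (if odd (i - 4) then field a true else field a false) = field a (odd (i - 4)).
  by case: odd.
by rewrite bit_field; congr bit; have := odd_double_half (i - 4); lia.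
Qed.

(** The converse of [field_lt]: whether a number is a gate can be tested on the lengths of its
    fields, by [fits]. *)
Lemma field_bound L a :
  field a false < 2 ^ L -> field a true < 2 ^ L -> a < 16 * 4 ^ L.
Proof.
move=> lt0 lt1; rewrite gate_bound.
apply: bit_small_ltn => j lej.
have -> : j = 4 + ((j - 4)./2.*2 + odd (j - 4)) by have := odd_double_half (j - 4); lia.
rewrite -bit_field; have lej2 : L <= (j - 4)./2 by lia.
by case: odd; apply: bit_small lej2.
Qed.

Section SumGates.

Variable L : nat.

Let pack_ord (p : 'I_16 * ('I_(2 ^ L) * 'I_(2 ^ L))) : 'I_(16 * 4 ^ L) :=
  Ordinal (pack_lt L p.2.1 p.2.2 (ltn_ord p.1)).

Let unpack_ord (g : 'I_(16 * 4 ^ L)) : 'I_16 * ('I_(2 ^ L) * 'I_(2 ^ L)) :=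
  (Ordinal (tag_lt g),
   (Ordinal (field_lt false (ltn_ord g)), Ordinal (field_lt true (ltn_ord g)))).

Lemma sum_gates (Q : nat -> nat -> nat -> nat) :
  \sum_(g < 16 * 4 ^ L) Q (tag g) (field g false) (field g true)
  = \sum_(t < 16) \sum_(h1 < 2 ^ L) \sum_(h2 < 2 ^ L) Q t h1 h2.
Proof.
under [RHS]eq_bigr => t _ do rewrite pair_big.
rewrite pair_big /= (reindex pack_ord) /=; last first.
  exists unpack_ord => [[t [h1 h2]]|g] _; last by apply/val_inj/packK/ltn_ord.
  congr (_, (_, _)); apply/val_inj; rewrite /= ?tag_pack ?field_pack //.
by apply: eq_bigr => -[t [h1 h2]] _ /=; rewrite tag_pack ?field_pack.
Qed.

End SumGates.

(** * Queries, wires and specifications *)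

Notation quantity := ('I_3 * bool + 'I_3)%type.

(* In a query (t, a, b): T, G and H are the two fields of t, of a and of b; PB is
   b itself, which for inputs and outputs is a plain number; NN is n; ZZ is 0. *)
Notation G1 := (inl (@Ordinal 3 1 isT, false) : quantity).
Notation G2 := (inl (@Ordinal 3 1 isT, true) : quantity).
Notation H1 := (inl (@Ordinal 3 2 isT, false) : quantity).
Notation H2 := (inl (@Ordinal 3 2 isT, true) : quantity).
Notation T1 := (inl (@Ordinal 3 0 isT, false) : quantity).
Notation T2 := (inl (@Ordinal 3 0 isT, true) : quantity).
Notation PB := (inr (@Ordinal 3 0 isT) : quantity).
Notation NN := (inr (@Ordinal 3 1 isT) : quantity).
Notation ZZ := (inr (@Ordinal 3 2 isT) : quantity).

(* For quantities u and v: u < v; u has at most as many bits as v; u + 1 = v. *)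
Definition relation := quantity -> quantity -> bool * bool * bool.

Definition lt (r : relation) u v := (r u v).1.1.
Definition fits (r : relation) u v := (r u v).1.2.
Definition suc (r : relation) u v := (r u v).2.
Definition le r u v := ~~ lt r v u.
Definition eqv r u v := le r u v && le r v u.

Definition compare (e : quantity -> nat) : relation :=
  fun u v => (e u < e v, e u < 2 ^ len (e v), (e u).+1 == e v).

Lemma eqv_compare e u v : eqv (compare e) u v = (e u == e v).
Proof. by rewrite /eqv /le /lt /= -!leqNgt eqn_leq andbC. Qed.

Definition env (t1 t2 g1 g2 h1 h2 b n : nat) (u : quantity) : nat :=
  match u with
  | inl (s, c) => nth 0 [:: t1; t2; g1; g2; h1; h2] (s.*2 + c)
  | inr k => nth 0 [:: b; n] k
  end.

Definition quantities (t a b n : nat) : quantity -> nat :=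
  env (field t false) (field t true) (field a false) (field a true)
      (field b false) (field b true) b n.

Variant kind : Type := KIn | KAnd | KOr | KNot | KMaj.

Variant edge : Type :=
  | ENone | EEq | ELe | ELt | EGt | EGe | EBetween | ERevBetween | EAll | EInit
  | EGeInit | ELast.

Definition edge_rel (e : edge) (r : relation) : bool :=
  match e with
  | ENone => false
  | EEq => eqv r H1 G1
  | ELe => le r H1 G1
  | ELt => lt r H1 G1
  | EGt => lt r G1 H1 && lt r H1 NN
  | EGe => le r G1 H1 && lt r H1 NN
  | EBetween => le r G1 H1 && le r H1 G2
  | ERevBetween => le r G2 H1 && le r H1 G1
  | EAll => lt r H1 NN
  | EInit => lt r H1 NN && ~~ suc r H1 NN
  | EGeInit => [&& le r G1 H1, lt r H1 NN & ~~ suc r H1 NN]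
  | ELast => suc r H1 NN
  end.

(** The machine evaluates [edge_rel]; the counts of children need the same condition as an interval
    for the first field of the child. *)
Definition edge_range (e : edge) (g1 g2 n : nat) : nat * nat :=
  match e with
  | ENone => (0, 0)
  | EEq => (g1, g1.+1)
  | ELe => (0, g1.+1)
  | ELt => (0, g1)
  | EGt => (g1.+1, n)
  | EGe => (g1, n)
  | EBetween => (g1, g2.+1)
  | ERevBetween => (g2, g1.+1)
  | EAll => (0, n)
  | EInit => (0, n.-1)
  | EGeInit => (g1, n.-1)
  | ELast => (n.-1, n)
  end.

(* A gate is a number with a tag (its four low bits) and two fields (the bits
   of even and of odd rank of the remaining bits). The children tagged u of a
   gate tagged t are those whose first field is in the range [sp_edge t u] and
   whose second field is the first field of the parent if [sp_diag t u], and 0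
   otherwise. *)
Record spec : Type := Spec {
  sp_kind : nat -> kind;
  sp_diag : nat -> nat -> bool;
  sp_edge : nat -> nat -> edge;
  sp_output : nat -> relation -> bool;
  sp_outputs : nat -> seq nat;
  sp_rank : nat -> nat
}.

Definition sp_wire (S : spec) (t u : nat) (r : relation) : bool :=
  eqv r H2 (if sp_diag S t u then G1 else ZZ) && edge_rel (sp_edge S t u) r.

Section Family.

Variable S : spec.

Definition family_size (n : nat) : nat := 16 * 4 ^ len n.

(** An input tag whose field is not below n gives a childless [Or], of value false, which agrees
    with the default in [nth false x]. *)
Definition family_gate (n : nat) (g : 'I_(family_size n)) : gate n :=
  match sp_kind S (tag g) with
  | KIn => if insub (field g false) is Some i then Input i else Or
  | KAnd => And
  | KOr => Or
  | KNot => Not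
  | KMaj => Maj
  end.

(** 5 is the code of [IsWire], so this is exactly the relation that the machine computes on a wire
    query. *)
Definition family_wire (n : nat) (g h : 'I_(family_size n)) : bool :=
  sp_wire S (tag g) (tag h) (compare (quantities 5 g h n)).

Definition family (n : nat) : circuit n :=
  @Circuit n (family_size n) (@family_gate n) (@family_wire n)
           (pmap insub (sp_outputs S n)).

Record spec_ok : Prop := {
  rank_lt : forall t, sp_rank S t < 16;
  rank_edge : forall t u r, t < 16 -> u < 16 ->
     edge_rel (sp_edge S t u) r -> sp_rank S u < sp_rank S t;
  in_edge : forall t u, t < 16 -> sp_kind S t = KIn -> sp_edge S t u = ENone;
  not_edge : forall t, t < 16 -> sp_kind S t = KNot -> exists2 c, c < 16 &
     forall u, sp_diag S t u = false /\ sp_edge S t u = if u == c then EEq else ENone;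
  output_size : forall n, size (sp_outputs S n) <= n.+1;
  output_lt : forall n a, a \in sp_outputs S n -> a < family_size n;
  output_onth : forall n a b t, a < family_size n ->
     (onth (sp_outputs S n) b == Some a) = sp_output S (tag a) (compare (quantities t a b n))
}.

Hypothesis ok : spec_ok.

Section Eval.

Variable n : nat.
Local Notation L := (len n).

Lemma edge_rangeP e b g1 g2 h1 h2 :
  edge_rel e (compare (env (field 5 false) (field 5 true) g1 g2 h1 h2 b n))
  = ((edge_range e g1 g2 n).1 <= h1 < (edge_range e g1 g2 n).2).
Proof. by case: e; rewrite /edge_rel /eqv /le /lt /suc /=; lia. Qed.

Lemma edge_range_le e g1 g2 : g1 < 2 ^ L -> g2 < 2 ^ L ->
  (edge_range e g1 g2 n).2 <= 2 ^ L.
Proof. by have := ltn_len n; case: e => /=; lia. Qed.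

Definition count_children (P : nat -> nat -> nat -> bool) (t g1 g2 : nat) : nat :=
  \sum_(u < 16)
    let r := edge_range (sp_edge S t u) g1 g2 n in
    \sum_(r.1 <= h < r.2) P u h (if sp_diag S t u then g1 else 0).

(** Once the tag of a child is fixed, its second field is forced and its first field runs through an
    interval inside [0, 2 ^ L), so all these children exist as gates. *)
Lemma sum_wires (P : nat -> nat -> nat -> bool) (g : 'I_(family_size n)) :
  \sum_(h < family_size n) (family_wire g h && P (tag h) (field h false) (field h true) : nat)
  = count_children P (tag g) (field g false) (field g true).
Proof.
set t := tag g; set g1 := field g false; set g2 := field g true.
have lt_g1 : g1 < 2 ^ L by apply/field_lt/ltn_ord.
have lt_g2 : g2 < 2 ^ L by apply/field_lt/ltn_ord.
pose Q u h1 h2 : nat := sp_wire S t u (compare (env (field 5 false) (field 5 true)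
    g1 g2 h1 h2 (pack L u h1 h2) n)) && P u h1 h2.
transitivity (\sum_(h < 16 * 4 ^ L) Q (tag h) (field h false) (field h true)).
  by apply: eq_bigr => h _; rewrite /Q packK ?ltn_ord.
rewrite sum_gates; apply: eq_bigr => u _ /=; set c := if _ then g1 else 0.
rewrite [RHS]big_nat_cond (big_nat_widenl _ 0) //.
rewrite (big_nat_widen _ _ (2 ^ L)) ?edge_range_le // big_mkord [RHS]big_mkcond /=.
apply: eq_bigr => h1 _; rewrite andbT.
have lt_c : c < 2 ^ L by rewrite /c; case: ifP; rewrite ?expn_gt0.
have wireE h2 : Q u h1 h2 = [&& h2 == c,
    (edge_range (sp_edge S t u) g1 g2 n).1 <= h1 < (edge_range (sp_edge S t u) g1 g2 n).2
    & P u h1 h2].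
  rewrite /Q /sp_wire edge_rangeP /eqv /le /lt /c /= -andbA.
  by case: (sp_diag S t u); rewrite /= -!leqNgt -eqn_leq eq_sym.
rewrite (bigD1 (Ordinal lt_c)) //= big1 => [|h2 neq_h2].
  by rewrite addn0 wireE eqxx /=; do 2!case: (_ <= _) => //=.
by rewrite wireE; move: neq_h2; rewrite -val_eqE => /negbTE /= ->.
Qed.

Lemma card_wires (P : nat -> nat -> nat -> bool) (g : 'I_(family_size n)) v :
  (forall h, family_wire g h -> v h = P (tag h) (field h false) (field h true)) ->
  #|[pred h | family_wire g h && v h]| =
  count_children P (tag g) (field g false) (field g true).
Proof.
move=> vP; rewrite -sum_wires -sum1_card big_mkcond; apply: eq_bigr => h _.
by rewrite inE; case w: (family_wire g h) => //=; rewrite vP //; case: (P _ _ _).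
Qed.

Lemma card_all_wires (g : 'I_(family_size n)) :
  #|[pred h | family_wire g h]| =
  count_children (fun _ _ _ => true) (tag g) (field g false) (field g true).
Proof.
by rewrite -(card_wires (v := fun => true)) //; apply: eq_card => h; rewrite !inE andbT.
Qed.

Lemma forall_wires (P : nat -> nat -> nat -> bool) (g : 'I_(family_size n)) v :
  (forall h, family_wire g h -> v h = P (tag h) (field h false) (field h true)) ->
  [forall h, family_wire g h ==> v h] =
  (count_children (fun u h1 h2 => ~~ P u h1 h2) (tag g) (field g false) (field g true) == 0).
Proof.
move=> vP; rewrite -(card_wires (v := fun h => ~~ v h)) => [|h /vP-> //].
apply/forallP/eqP => [all_h|/eqP/pred0P none h].
  by apply/eqP/pred0P => h; rewrite /= -negb_imply all_h.
by rewrite -[_ ==> _]negbK negb_imply; apply/negbT/none.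
Qed.

Lemma count_not c P t g1 g2 : c < 16 ->
  (forall u, sp_diag S t u = false /\ sp_edge S t u = if u == c then EEq else ENone) ->
  count_children P t g1 g2 = P c g1 0.
Proof.
move=> lt_c cP; rewrite /count_children (bigD1 (Ordinal lt_c)) //=.
rewrite [X in _ + X]big1 => [|u neq_u]; last first.
  have [_ ->] := cP u; move: neq_u; rewrite -val_eqE /= => /negbTE->; exact: big_geq.
by have [-> ->] := cP c; rewrite eqxx /= big_nat1 addn0.
Qed.

Variables (x : n.-tuple bool) (sem : nat -> nat -> nat -> bool).

(** Consistency of the intended values, gate by gate. As wires decrease [sp_rank], it determines the
    value of every gate. *)
Definition sem_ok : Prop := forall t g1 g2, t < 16 -> g1 < 2 ^ L -> g2 < 2 ^ L ->
  sem t g1 g2 =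
  match sp_kind S t with
  | KIn => nth false x g1
  | KAnd => count_children (fun u h1 h2 => ~~ sem u h1 h2) t g1 g2 == 0
  | KOr => 0 < count_children sem t g1 g2
  | KNot => count_children (fun u h1 h2 => ~~ sem u h1 h2) t g1 g2 == 1
  | KMaj => count_children (fun _ _ _ => true) t g1 g2 < (count_children sem t g1 g2).*2
  end.

Hypothesis semP : sem_ok.

Lemma wire_rank (g h : 'I_(family_size n)) :
  family_wire g h -> sp_rank S (tag h) < sp_rank S (tag g).
Proof. by case/andP=> _; apply: rank_edge; rewrite ?tag_lt. Qed.

Lemma gate_valE fuel (g : 'I_(family_size n)) : sp_rank S (tag g) < fuel ->
  @gate_val n (family n) x fuel g = sem (tag g) (field g false) (field g true).
Proof.
elim: fuel g => // fuel IH g lt_rank.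
have valP h : family_wire g h ->
    @gate_val n (family n) x fuel h = sem (tag h) (field h false) (field h true).
  by move=> /wire_rank lt_h; apply: IH; lia.
have lt_g c : field g c < 2 ^ L by apply/field_lt/ltn_ord.
rewrite (semP (tag_lt g) (lt_g false) (lt_g true)) /= /family_gate.
case kg: (sp_kind S (tag g)); last 1 first.
- by rewrite card_all_wires (card_wires valP) mul2n.
- have [ltn|leq] := ltnP (field g false) n.
    by rewrite insubT /= (tnth_nth false).
  rewrite insubF /= ?nth_default ?size_tuple //; last by rewrite ltnNge leq.
  apply/existsP => -[h /andP[/andP[_]]].
  by rewrite (in_edge ok) ?tag_lt.
- exact: forall_wires.
- rewrite -(card_wires valP); apply/existsP/card_gt0P => -[h hP]; exists h; exact: hP.
- have [c lt_c cP] := not_edge ok (tag_lt g) kg.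
  rewrite (forall_wires (P := fun u h1 h2 => ~~ sem u h1 h2)) => [|h /valP-> //].
  by rewrite !(count_not _ _ _ lt_c cP); case: (sem _ _ _).
Qed.

Lemma family_val : circuit_val (family n) x =
  [seq sem (tag a) (field a false) (field a true) | a <- sp_outputs S n].
Proof.
rewrite /circuit_val /=; have := @output_lt ok n.
elim: (sp_outputs S n) => //= a s IH lt_s.
have lt_a : a < family_size n by apply: lt_s; rewrite mem_head.
rewrite insubT /= gate_valE; last first.
  (* There are at least 16 gates, so the fuel exceeds every rank. *)
  apply: leq_trans (rank_lt ok _) _.
  by rewrite /family_size leq_pmulr // expn_gt0.
by rewrite IH // => b sb; apply: lt_s; rewrite inE sb orbT.
Qed.

End Eval.

Lemma family_well_formed n : well_formed (family n).
Proof.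
move=> g; rewrite /= /family_gate; case kg: (sp_kind S (tag g)) => //.
  case: insub => // i; apply: eq_card0 => h; rewrite !inE.
  by rewrite /family_wire /sp_wire (in_edge ok) ?tag_lt ?andbF.
have [c lt_c cP] := not_edge ok (tag_lt g) kg.
rewrite card_all_wires (count_not _ _ _ _ lt_c cP) //.
Qed.

Lemma family_constant_depth : constant_depth family.
Proof.
exists 16 => n g p; suff: path (@wire n (family n)) g p -> size p <= sp_rank S (tag g).
  by move=> le_p /le_p; have := rank_lt ok (tag g); lia.
elim: p g => //= h p IH g /andP[/wire_rank lt_h /IH]; lia.
Qed.

Lemma family_polynomial_size : polynomial_size family.
Proof.
(* For N >= 2 the size is at most 64 * N ^ 2 <= N ^ 8. The value 64 is chosen for its second role as
   additive constant, where it covers the 16 gates for n = 0 and the 64 gates for n = 1. *)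
exists 64 => n; rewrite /= /family_size.
case: n => [|[|n]]; rewrite ?exp1n //.
set N := n.+2; have le_len : 2 ^ len N <= 2 * N.
  have := @up_log_gtn 2 N.+1 isT isT; rewrite -/(len N) ltnS len_half //= expnS.
  by rewrite leq_pmul2l.
apply: leq_trans (leq_addr _ _).
have -> : 16 * 4 ^ len N = 2 ^ 4 * (2 ^ len N) ^ 2 by rewrite gate_bound expnD -muln2 expnM.
apply: leq_trans (_ : 2 ^ 6 * N ^ 2 <= _).
  by rewrite (_ : 2 ^ 6 * _ = 2 ^ 4 * (2 * N) ^ 2) ?leq_mul2l ?leq_exp2r // expnMn mulnA.
apply: leq_trans (_ : N ^ 6 * N ^ 2 <= _); first by rewrite leq_mul2r leq_exp2r // orbT.
by rewrite -expnD leq_pexp2l.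
Qed.

End Family.

(** * Circuits for psi and its inverse *)

Lemma sum16 (F : nat -> nat) :
  \sum_(u < 16) F u = F 0 + F 1 + F 2 + F 3 + F 4 + F 5 + F 6 + F 7 + F 8 + F 9
    + F 10 + F 11 + F 12 + F 13 + F 14 + F 15.
Proof. by rewrite !big_ord_recr big_ord0. Qed.

Lemma pack_eq L t f1 f2 a : a < 16 * 4 ^ L -> t < 16 -> f1 < 2 ^ L -> f2 < 2 ^ L ->
  (pack L t f1 f2 == a) = [&& tag a == t, field a false == f1 & field a true == f2].
Proof.
move=> lt_a lt_t lt1 lt2; apply/eqP/and3P => [<-|[/eqP<- /eqP<- /eqP<-]]; last exact: packK.
by rewrite tag_pack ?field_pack.
Qed.

Lemma sum_empty (F : nat -> nat) : \sum_(0 <= h < 0) F h = 0.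
Proof. exact: big_geq. Qed.

Lemma sum_neg (F : nat -> bool) a b : zeros F a b = (b - a) - ones F a b.
Proof.
have : ones F a b + zeros F a b = b - a.
  rewrite -big_split /= -[RHS]muln1 -sum_nat_const_nat.
  by apply: eq_bigr => h _; case: (F h).
by lia.
Qed.

Lemma sum_le_size (F : nat -> bool) a b : ones F a b <= b - a.
Proof.
rewrite -[leqRHS]muln1 -sum_nat_const_nat.
by apply: leq_sum => h _; case: (F h).
Qed.

Lemma sum_one a b : \sum_(a <= h < b) 1 = b - a.
Proof. by rewrite sum_nat_const_nat muln1. Qed.

Lemma sum_eq0_all (F : nat -> bool) a b :
  (zeros F a b == 0) = all F (iota a (b - a)).
Proof.
rewrite sum_nat_seq_eq0; apply: eq_in_all => h _.
by case: (F h).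
Qed.

Lemma sum_gt0_has (F : nat -> bool) a b :
  (0 < ones F a b) = has F (iota a (b - a)).
Proof.
rewrite lt0n sum_nat_seq_neq0; apply: eq_in_has => h _.
by case: (F h).
Qed.

(* The tags are explained by [psi_sem] below. *)
Definition psi_kind (t : nat) : kind :=
  match t with
  | 0 => KIn
  | 1 | 4 | 13 => KNot
  | 2 | 7 | 8 => KMaj
  | 3 | 5 | 9 | 11 => KAnd
  | _ => KOr
  end.

(** Tags 5 and 6 are the constants 1 and 0, as [And] and [Or] without children. Gates 7 and 8
    compare a count A over a positions with a count B over b positions: they receive the bits of the
    first range, the negated bits of the second, a constants 1 and b constants 0. Then A + (b - B) +
    a of the 2 * (a + b) inputs are 1, a strict majority iff B < A. *)
Definition psi_edge (t u : nat) : edge :=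
  match t, u with
  | 1, 0 | 4, 3 | 9, 3 | 9, 7 | 10, 0 | 10, 9 | 11, 8 | 11, 9 | 13, 12 => EEq
  | 2, 1 => EBetween
  | 3, 2 | 7, 3 | 7, 5 => ELe
  | 7, 4 | 7, 6 => EGt
  | 8, 3 | 8, 5 => EGe
  | 8, 4 | 8, 6 => ELt
  | 12, 11 => EAll
  | _, _ => ENone
  end.

Definition psi_spec : spec := {|
  sp_kind := psi_kind;
  sp_diag := fun t u => (t == 3) && (u == 2);
  sp_edge := psi_edge;
  sp_output := fun t r =>
    [&& t == 10, eqv r G1 PB, eqv r G2 ZZ & lt r PB NN]
    || [&& t == 13, eqv r G1 ZZ, eqv r G2 ZZ & eqv r PB NN];
  sp_outputs := fun n => rcons (mkseq (fun i => pack (len n) 10 i 0) n) (pack (len n) 13 0 0);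
  sp_rank := fun t => t %% 16 |}.

(** Every edge leads to a smaller tag, so the tag itself serves as rank. *)
Lemma psi_spec_ok : spec_ok psi_spec.
Proof.
split.
- by move=> t; apply: ltn_pmod.
- move=> t u r lt_t lt_u; do 14?[case: t lt_t => [|t] lt_t //];
   do 13?[case: u lt_u => [|u] lt_u //].
- by move=> t u; do 14?[case: t => [|t] //].
- move=> t lt_t; do 14?[case: t lt_t => [|t] lt_t //]; move=> _.
  + by exists 0 => // u; do 1?[case: u => [|u] //].
  + by exists 3 => // u; do 4?[case: u => [|u] //].
  + by exists 12 => // u; do 13?[case: u => [|u] //].
- by move=> n; rewrite size_rcons size_mkseq.
- move=> n a; rewrite mem_rcons inE => /orP[/eqP->|/mapP[i _ ->]]; exact: pack_lt.
move=> n a b t lt_a /=; rewrite !eqv_compare /lt /=.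
have ltn := ltn_len n; have pos : 0 < 2 ^ len n by rewrite expn_gt0.
rewrite onthE map_rcons nth_rcons size_map size_mkseq.
case: (ltngtP b n) => [ltbn|//|->].
- rewrite (nth_map 0) ?size_mkseq // nth_mkseq //.
  rewrite (_ : (Some _ == Some a) = (pack (len n) 10 b 0 == a)) // pack_eq //; last by lia.
  by rewrite !andbT !andbF orbF.
- by rewrite !andbF.
by rewrite (_ : (Some _ == Some a) = (pack (len n) 13 0 0 == a)) // pack_eq // !andbT !andbF.
Qed.

Section PsiEval.

Variables (n : nat) (x : n.-tuple bool).

Local Notation f := (nth false x).
Local Notation F := (free0b f).

Definition psi_sem (t g1 g2 : nat) : bool :=
  let upper := ones F g1.+1 n < ones F 0 g1.+1 in
  match t with
  | 0 => f g1
  | 1 => ~~ f g1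
  | 2 => ones f g1 g2.+1 < zeros f g1 g2.+1
  | 3 => F g1
  | 4 => ~~ F g1
  | 5 => true
  | 7 => upper
  | 8 => ones F 0 g1 < ones F g1 n
  | 9 => F g1 && upper
  | 10 => f g1 || F g1 && upper
  | 11 => [&& F g1, upper & ones F 0 g1 < ones F g1 n]
  | 12 => has (fun i => [&& F i, ones F i.+1 n < ones F 0 i.+1
                          & ones F 0 i < ones F i n]) (iota 0 n)
  | 13 => ~~ has (fun i => [&& F i, ones F i.+1 n < ones F 0 i.+1
                          & ones F 0 i < ones F i n]) (iota 0 n)
  | _ => false
  end.

Lemma psi_sem_ok : sem_ok psi_spec x psi_sem.
Proof.
move=> t g1 g2 lt_t lt_g1 lt_g2.
have countE P : count_children psi_spec n P t g1 g2 = _ := sum16 (fun u =>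
  let r := edge_range (sp_edge psi_spec t u) g1 g2 n in
  \sum_(r.1 <= h < r.2) P u h (if sp_diag psi_spec t u then g1 else 0)).
rewrite !{}countE.
do 14?[case: t lt_t => [|t] lt_t] => //=; rewrite ?sum_empty ?big_nat1 ?addn0 ?add0n //.
- by case: (f g1).
- by rewrite sum_one sum_neg; have := sum_le_size f g1 g2.+1; lia.
- by rewrite sum_eq0_all subn0.
- by case: (F g1).
- rewrite !sum_one big1_eq sum_neg.
  by have := sum_le_size F g1.+1 n; have := sum_le_size F 0 g1.+1; lia.
- rewrite !sum_one big1_eq sum_neg.
  by have := sum_le_size F g1 n; have := sum_le_size F 0 g1; lia.
- by case: (F g1); case: (_ < _).
- by case: (f g1); case: (_ && _).
- by case: (F g1); do 2!case: (_ < _).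
- by rewrite sum_gt0_has subn0.
- by case: (has _ _).
Qed.

End PsiEval.

Lemma circuit_val_in_tuple (C : forall n, circuit n) n (x : n.-tuple bool) :
  circuit_val (C (size x)) (in_tuple x) = circuit_val (C n) x.
Proof.
case: x => s /[dup] /eqP <- sz_s /=; congr (circuit_val _ _); exact: val_inj.
Qed.

Lemma psi_family_computes : computes (family psi_spec) psi_graph.
Proof.
move=> u v [n x _] {u v}.
rewrite circuit_val_in_tuple (family_val psi_spec_ok (psi_sem_ok x)) /=.
have pos : 0 < 2 ^ len n by rewrite expn_gt0.
apply: (@eq_from_nth _ false) => [|i].
  by rewrite size_map size_rcons size_mkseq size_tuple.
rewrite size_map size_rcons size_mkseq ltnS leq_eqVlt.
rewrite map_rcons nth_rcons !size_map size_iota => /orP[/eqP->|ltin].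
  by rewrite ltnn eqxx tag_pack ?field_pack // psi_last_free.
have ltiL : i < 2 ^ len n by apply: ltn_trans ltin (ltn_len n).
rewrite ltin (nth_map 0) ?size_mkseq // nth_mkseq // tag_pack // !field_pack //=.
by rewrite nth_psi_free.
Qed.

(* The input of the circuit is y, of length n.+1: EInit and EGeInit leave out its
   last bit, and ELast selects it. The tags are explained by [inv_sem] below. *)
Definition inv_kind (t : nat) : kind :=
  match t with
  | 0 => KIn
  | 1 | 8 | 11 => KNot
  | 2 | 6 | 9 => KMaj
  | 3 | 4 | 7 | 10 | 12 => KAnd
  | _ => KOr
  end.

(** [sp_diag] passes the fixed end of an interval as second field; for [free1] this is the left end,
    hence [ERevBetween]. For y of length n + 1, gate 9 receives n bits [Z], the negated last bit, g1
    negated bits [O], n + 1 constants 1 and g1 constants 0, which makes a strict majority express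
    the inequality [low]. *)
Definition inv_edge (t u : nat) : edge :=
  match t, u with
  | 1, 0 | 8, 7 | 10, 7 | 10, 9 | 11, 10 | 12, 0 | 12, 11 => EEq
  | 2, 1 => EBetween
  | 3, 2 => ELe
  | 6, 0 => ERevBetween
  | 7, 6 => EGeInit
  | 9, 1 => ELast
  | 9, 3 => EInit
  | 9, 4 => EAll
  | 9, 5 | 9, 8 => ELt
  | _, _ => ENone
  end.

Definition inv_spec : spec := {|
  sp_kind := inv_kind;
  sp_diag := fun t u => (t == 3) && (u == 2) || (t == 7) && (u == 6);
  sp_edge := inv_edge;
  sp_output := fun t r =>
    [&& t == 12, eqv r G1 PB, eqv r G2 ZZ, lt r PB NN & ~~ suc r PB NN];
  sp_outputs := fun n => mkseq (fun i => pack (len n) 12 i 0) n.-1;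
  sp_rank := fun t => t %% 16 |}.

Lemma inv_spec_ok : spec_ok inv_spec.
Proof.
split.
- by move=> t; apply: ltn_pmod.
- move=> t u r lt_t lt_u; do 13?[case: t lt_t => [|t] lt_t //];
   do 12?[case: u lt_u => [|u] lt_u //].
- by move=> t u; do 13?[case: t => [|t] //].
- move=> t lt_t; do 13?[case: t lt_t => [|t] lt_t //]; move=> _.
  + by exists 0 => // u; do 1?[case: u => [|u] //].
  + by exists 7 => // u; do 8?[case: u => [|u] //].
  + by exists 10 => // u; do 11?[case: u => [|u] //].
- by move=> n; rewrite size_mkseq; lia.
- move=> n a => /mapP[i _ ->]; exact: pack_lt.
move=> n a b t lt_a /=; rewrite !eqv_compare /lt /suc /=.
have ltn := ltn_len n; have pos : 0 < 2 ^ len n by rewrite expn_gt0.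
have -> : (b < n) && (b.+1 != n) = (b < n.-1) by lia.
case: (ltnP b n.-1) => [ltbn|lenb]; last first.
  by rewrite onth_default ?size_mkseq // !andbF.
rewrite onthE (nth_map 0) ?size_mkseq // nth_mkseq //.
rewrite (_ : (Some _ == Some a) = (pack (len n) 12 b 0 == a)) // pack_eq //; last by lia.
by rewrite !andbT.
Qed.

Section InvEval.

Variables (n : nat) (y : n.+1.-tuple bool).

Local Notation f := (nth false y).
Local Notation Z := (free0b f).
Local Notation O := (free1b f n).

Definition inv_sem (t g1 g2 : nat) : bool :=
  let low := ones O 0 g1 < ones Z 0 n + ~~ f n in
  match t with
  | 0 => f g1
  | 1 => ~~ f g1
  | 2 => ones f g1 g2.+1 < zeros f g1 g2.+1
  | 3 => Z g1
  | 4 => true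
  | 6 => zeros f g2 g1.+1 < ones f g2 g1.+1
  | 7 => O g1
  | 8 => ~~ O g1
  | 9 => low
  | 10 => O g1 && low
  | 11 => ~~ (O g1 && low)
  | 12 => f g1 && ~~ (O g1 && low)
  | _ => false
  end.

Lemma inv_sem_ok : sem_ok inv_spec y inv_sem.
Proof.
move=> t g1 g2 lt_t lt_g1 lt_g2.
have countE P : count_children inv_spec n.+1 P t g1 g2 = _ := sum16 (fun u =>
  let r := edge_range (sp_edge inv_spec t u) g1 g2 n.+1 in
  \sum_(r.1 <= h < r.2) P u h (if sp_diag inv_spec t u then g1 else 0)).
rewrite !{}countE.
do 13?[case: t lt_t => [|t] lt_t] => //=; rewrite ?sum_empty ?big_nat1 ?addn0 ?add0n //.
- by case: (f g1).
- by rewrite sum_one sum_neg; have := sum_le_size f g1 g2.+1; lia.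
- by rewrite sum_eq0_all subn0.
- by rewrite sum_one sum_neg; have := sum_le_size f g2 g1.+1; lia.
- by rewrite sum_eq0_all.
- by case: (O g1).
- rewrite !sum_one big1_eq sum_neg.
  by have := sum_le_size O 0 g1; have := sum_le_size Z 0 n; lia.
- by case: (O g1); case: (_ < _).
- by rewrite eqb1.
- by case: (f g1); case: (O g1 && _).
Qed.

End InvEval.

Lemma inv_family_computes : computes (family inv_spec) psi_inv_graph.
Proof.
move=> u v [n y n_even y_heavy] {u v}; rewrite psi_invE //.
rewrite circuit_val_in_tuple (family_val inv_spec_ok (inv_sem_ok y)) [sp_outputs _ _]/=.
have pos : 0 < 2 ^ len n.+1 by rewrite expn_gt0.
apply: (@eq_from_nth _ false) => [|i].
  by rewrite size_map size_mkseq size_tuple.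
rewrite size_map size_mkseq => ltin.
have ltiL : i < 2 ^ len n.+1 by have := ltn_len n.+1; lia.
rewrite (nth_map 0) ?size_mkseq // nth_mkseq // tag_pack // !field_pack //=.
by rewrite nth_unpsi_free.
Qed.

(** * A logarithmic time machine for the direct connection language *)

Definition setbit (v p : nat) (b : bool) : nat :=
  ofbits (maxn v p.+1) (fun i => if i == p then b else bit v i).

Lemma bit_setbit v p b i : bit (setbit v p b) i = if i == p then b else bit v i.
Proof.
rewrite bit_ofbits; case: eqP => [->|_]; first by rewrite leq_max leqnn orbT.
rewrite leq_max; case: ltnP => //= levi.
by rewrite (@bit_small v v) ?andbF // ltn_expl.
Qed.

Definition digits := {ffun 'I_3 -> bool * bool}.
Definition no_digits : digits := [ffun=> (false, false)].
Definition mdata : Type := option bool * digits.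
Definition relstate := {ffun quantity * quantity -> bool * bool * bool * bool}.

(* The PUp phases find the least P with N <= 2 ^ P, the PDown phases N - 1 by
   binary search, N being the length of the input; PClear resets the address.
   PRead (s, ok, ph) reads the s-th numeral, ok telling whether it is canonical
   if it ends here and ph the parity of the number of bits read so far; PIncr and
   PBack increment the address. PFin0 and PFin1 read the tags, PFin2 compares the
   quantities, with a carry and the current state of the comparisons. *)
Variant phase : Type :=
  | PInit0 | PInit1 | PUpSet | PUpTest | PDown | PDownSet | PDownTest | PClear
  | PRewind of 'I_4
  | PRead of 'I_3 * bool * bool
  | PIncr of 'I_3 * bool * bool
  | PBack of 'I_3 * bool * bool
  | PFin0
  | PFin1 of digits
  | PFin2 of digits * digits * bool * relstate
  | PHalt of bool.

Definition phase_code (q : phase) :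
  'I_9 + 'I_4 + 'I_3 * ('I_3 * bool * bool) + digits + (digits * digits * bool * relstate) + bool :=
  match q with
  | PInit0 => inl (inl (inl (inl (inl (@Ordinal 9 0 isT)))))
  | PInit1 => inl (inl (inl (inl (inl (@Ordinal 9 1 isT)))))
  | PUpSet => inl (inl (inl (inl (inl (@Ordinal 9 2 isT)))))
  | PUpTest => inl (inl (inl (inl (inl (@Ordinal 9 3 isT)))))
  | PDown => inl (inl (inl (inl (inl (@Ordinal 9 4 isT)))))
  | PDownSet => inl (inl (inl (inl (inl (@Ordinal 9 5 isT)))))
  | PDownTest => inl (inl (inl (inl (inl (@Ordinal 9 6 isT)))))
  | PClear => inl (inl (inl (inl (inl (@Ordinal 9 7 isT)))))
  | PFin0 => inl (inl (inl (inl (inl (@Ordinal 9 8 isT)))))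
  | PRewind k => inl (inl (inl (inl (inr k))))
  | PRead r => inl (inl (inl (inr (@Ordinal 3 0 isT, r))))
  | PIncr r => inl (inl (inl (inr (@Ordinal 3 1 isT, r))))
  | PBack r => inl (inl (inl (inr (@Ordinal 3 2 isT, r))))
  | PFin1 d => inl (inl (inr d))
  | PFin2 d => inl (inr d)
  | PHalt b => inr b
  end.

Definition phase_decode (c : 'I_9 + 'I_4 + 'I_3 * ('I_3 * bool * bool) + digits
    + (digits * digits * bool * relstate) + bool) : phase :=
  match c with
  | inl (inl (inl (inl (inl i)))) =>
    nth PInit0 [:: PInit0; PInit1; PUpSet; PUpTest; PDown; PDownSet; PDownTest; PClear; PFin0] i
  | inl (inl (inl (inl (inr k)))) => PRewind k
  | inl (inl (inl (inr (i, r)))) => nth PRead [:: PRead; PIncr; PBack] i r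
  | inl (inl (inr d)) => PFin1 d
  | inl (inr d) => PFin2 d
  | inr b => PHalt b
  end.

Lemma phase_codeK : cancel phase_code phase_decode.
Proof. by case. Qed.

HB.instance Definition _ := Finite.copy phase (can_type phase_codeK).

Record action : Type := Action {
  next : phase;
  act_addr : option bool * move;
  act_main : option mdata * move;
  act_plain : option (option bool) * move
}.

Definition is_init (q : phase) : bool := if q is PInit0 then true else false.

Definition halted (q : phase) : option bool := if q is PHalt b then Some b else None.

Notation s2 := (@Ordinal 3 2 isT).

Definition rewind_next (k : 'I_4) : phase :=
  match val k with
  | 0 => PRead (@Ordinal 3 0 isT, true, false)
  | 1 => PIncr (@Ordinal 3 1 isT, true, false)
  | 2 => PIncr (s2, true, false)
  | _ => PFin0
  end.

(* Comparisons of the j lowest bits of x and y: x < y, x fits in the length of y,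
   x + 1 = y, and x + 1 = y + 2 ^ j, needed to maintain the third one. *)
Definition rel_init : relstate := [ffun=> (false, true, false, true)].

Definition rel_update (st : relstate) (d : quantity -> bool) : relstate :=
  [ffun uv => let: (l, f, s, c) := st uv in let x := d uv.1 in let y := d uv.2 in
    (if x == y then l else y, if y then true else ~~ x && f,
     s && (x == y) || [&& c, ~~ x & y], [&& c, x & ~~ y])].

Definition tag_of (d0 d1 : digits) (s : 'I_3) : nat :=
  bval [:: (d0 s).1; (d0 s).2; (d1 s).1; (d1 s).2].

Section Transition.

Variable dec : nat -> nat -> nat -> relation -> bool.

(* [inp] is the input letter; [az], [al] tell whether the address head is on
   its first cell and the bit it reads; likewise [mz], [md] and [qz], [qd] for
   the main and the plain tape. *)
Definition transition (q : phase) (inp : option symbol) (az al mz : bool)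
    (md : mdata) (qz : bool) (qd : option bool) : action :=
  let go q' := Action q' (None, Stay) (None, Stay) (None, Stay) in
  match q with
  | PInit0 => if inp is None then go (PHalt false)
      else Action PInit1 (None, Stay) (Some (Some false, no_digits), MoveRight) (None, Stay)
  | PInit1 => Action PUpSet (None, Stay) (Some (Some false, no_digits), MoveRight) (None, Stay)
  | PUpSet => Action PUpTest (Some true, Stay) (None, Stay) (None, Stay)
  | PUpTest => if inp is None then Action PDown (Some false, Stay) (None, Stay) (None, Stay)
      else Action PUpSet (Some false, MoveRight)
                  (Some (Some false, no_digits), MoveRight) (None, Stay)
  | PDown => if az then go PClear
      else Action PDownSet (None, MoveLeft) (None, MoveLeft) (None, Stay)
  | PDownSet => Action PDownTest (Some true, Stay) (None, Stay) (None, Stay)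
  | PDownTest => let b := inp != None in
      Action PDown (Some b, Stay) (Some (Some b, no_digits), Stay) (None, Stay)
  | PClear => if md.1 is None then go (PRewind (@Ordinal 4 0 isT))
      else Action PClear (Some false, MoveRight) (None, MoveRight) (None, Stay)
  | PRewind k => if [&& az, mz & qz] then go (rewind_next k)
      else Action (PRewind k) (None, MoveLeft) (None, MoveLeft) (None, MoveLeft)
  | PRead (s, ok, ph) =>
      match inp with
      | None => go (PHalt false)
      | Some None => if ok then go (PRewind (lift ord0 s)) else go (PHalt false)
      | Some (Some b) =>
        if md.1 is None then go (PHalt false) else
        let d := [ffun i => if i == s then (if ph then ((md.2 i).1, b) else (b, false))
                            else md.2 i] in
        Action (PIncr (s, b, ~~ ph)) (None, Stay)
          (Some (md.1, d), if ph then MoveRight else Stay)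
          (if s == s2 then (Some (Some b), MoveRight) else (None, Stay))
      end
  | PIncr r => if al then Action (PIncr r) (Some false, MoveRight) (None, Stay) (None, Stay)
      else Action (PBack r) (Some true, Stay) (None, Stay) (None, Stay)
  | PBack r => if az then go (PRead r)
      else Action (PBack r) (None, MoveLeft) (None, Stay) (None, Stay)
  | PFin0 => Action (PFin1 md.2) (None, Stay) (None, MoveRight) (None, Stay)
  | PFin1 d0 => Action (PFin2 (d0, md.2, false, rel_init))
                  (None, Stay) (None, MoveRight) (None, Stay)
  | PFin2 (d0, d1, c, st) =>
      if (md.1 == None) && (qd == None) then
        go (PHalt (dec (tag_of d0 d1 (@Ordinal 3 0 isT)) (tag_of d0 d1 (@Ordinal 3 1 isT))
                       (tag_of d0 d1 s2) (fun u v => (st (u, v)).1)))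
      else
        let x := odflt false md.1 (+) al (+) c in
        let digit (u : quantity) : bool := match u with
          | inl (s, c) => if c then (md.2 s).2 else (md.2 s).1
          | inr k => nth false [:: odflt false qd; x] (nat_of_ord k)
          end in
        Action (PFin2 (d0, d1, x && al || c && (x || al), rel_update st digit))
          (None, MoveRight) (None, MoveRight) (None, MoveRight)
  | PHalt b => go (PHalt b)
  end.

(* The main tape and the plain tape have their data in the second component of
   the letters; the first one marks the leftmost cell. The third tape only
   serves to mark the leftmost cell of the address tape, whose head moves
   together with its own. *)
Definition cell : Type := bool * mdata.
Definition blank_cell : cell := (false, (None, no_digits)).

Definition tm_delta (q : phase) (inp : option symbol) (al : option bool)
    (f : {ffun 'I_3 -> cell}) : phase * (option bool * move) * {ffun 'I_3 -> cell * move} :=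
  let fm := f (@Ordinal 3 0 isT) in
  let fq := f (@Ordinal 3 1 isT) in
  let fz := f (@Ordinal 3 2 isT) in
  let first := is_init q in
  let a := transition q inp fz.1 (al == Some true) fm.1 fm.2 fq.1 fq.2.1 in
  (next a, (if (act_addr a).1 is Some b then Some b else al, (act_addr a).2),
   [ffun i : 'I_3 => match val i with
     | 0 => ((fm.1 || first, odflt fm.2 (act_main a).1), (act_main a).2)
     | 1 => ((fq.1 || first, (odflt fq.2.1 (act_plain a).1, fq.2.2)), (act_plain a).2)
     | _ => ((fz.1 || first, fz.2), (act_addr a).2)
     end]).

Definition tm : machine symbol :=
  @Machine symbol phase cell blank_cell 3 PInit0 halted tm_delta.

(** * Simulation of the machine by configurations made of numbers and functions *)

Record aconfig : Type := A {
  aphase : phase;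
  addr_pos : nat; addr_val : nat;
  main_pos : nat; main : nat -> mdata;
  plain_pos : nat; plain : nat -> option bool
}.

Definition shift (m : move) (p : nat) : nat :=
  match m with MoveLeft => p.-1 | MoveRight => p.+1 | Stay => p end.

Definition upd T (f : nat -> T) (p : nat) (w : option T) : nat -> T :=
  if w is Some v then fun i => if i == p then v else f i else f.

Definition astep (w : seq symbol) (c : aconfig) : aconfig :=
  let: A q ap av mp mc qp qc := c in
  if halted q is Some _ then c else
  let a := transition q (onth w av) (ap == 0) (bit av ap) (mp == 0) (mc mp) (qp == 0) (qc qp) in
  A (next a)
    (shift (act_addr a).2 ap) (if (act_addr a).1 is Some b then setbit av ap b else av)
    (shift (act_main a).2 mp) (upd mc mp (act_main a).1)
    (shift (act_plain a).2 qp) (upd qc qp (act_plain a).1).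

(** The initial phase is excluded because its step is the one that marks the leftmost cells; the
    simulation therefore starts one step later, at [aconfig1]. *)
Definition represents (c : config tm) (a : aconfig) : Prop :=
  [/\ cstate c = aphase a /\ ~~ is_init (aphase a),
      head_pos (caddress c) = addr_pos a
      /\ (forall i, (nth None (cells (caddress c)) i == Some true) = bit (addr_val a) i),
      head_pos (cwork c (@Ordinal 3 0 isT)) = main_pos a
      /\ (forall i, nth blank_cell (cells (cwork c (@Ordinal 3 0 isT))) i = (i == 0, main a i)),
      head_pos (cwork c (@Ordinal 3 1 isT)) = plain_pos a
      /\ (forall i, let x := nth blank_cell (cells (cwork c (@Ordinal 3 1 isT))) i in
           x.1 = (i == 0) /\ x.2.1 = plain a i)
    & head_pos (cwork c (@Ordinal 3 2 isT)) = addr_pos a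
      /\ (forall i, (nth blank_cell (cells (cwork c (@Ordinal 3 2 isT))) i).1 = (i == 0))].

Lemma address_val t v :
  (forall i, (nth None (cells t) i == Some true) = bit v i) -> address t = v.
Proof.
move=> tv; rewrite /address -[RHS](@ofbits_bit (size (cells t))).
  by apply: eq_bigr => i _; rewrite tv.
apply: bit_small_ltn => j lej; rewrite -tv nth_default //.
Qed.

Lemma next_not_init q inp az al mz md qz qd :
  ~~ is_init (next (transition q inp az al mz md qz qd)).
Proof.
case: q => [||||||||k|[[s ok] ph]|r|r||d|[[[d0 d1] c] st]|b] /=;
  try by [case: inp | case: az | case: md => -[] | case: al].
- by case: ifP => // _; rewrite /rewind_next; case: (val k) => [|[|[|]]].
- case: inp => [[b|]|] //; last by case: ok.
  by case: md.1.
- by case: ifP.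
Qed.

Lemma represents_step w c a :
  represents c a -> represents (step w c) (astep w a).
Proof.
case: c a => [q at_ work] [q' ap av mp mc qp qc] [/= [-> {q} not_init]].
case=> hap vap [hmp vmp] [hqp vqp] [hzp vzp].
rewrite /step /=; case: (halted q') => [b|] /=; first by split.
rewrite (address_val vap) /tape_read !ffunE hmp vmp hqp hzp vzp hap vap.
have [e1 e2] := vqp qp; rewrite e1 e2 /= (negbTE not_init).
have := next_not_init q' (onth w av) (ap == 0) (bit av ap) (mp == 0) (mc mp) (qp == 0) (qc qp).
set a := transition _ _ _ _ _ _ _ _ => next_ok.
split=> /=; rewrite ?ffunE /=.
- by [].
- rewrite hap; split; first by case: (act_addr a).2.
  move=> i; rewrite nth_set_nth /=; case: (act_addr a).1 => [b|].
    by rewrite bit_setbit; case: (i == ap); [case: b | exact: vap].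
  by case: (eqVneq i ap) => [->|_]; exact: vap.
- rewrite hmp orbF; split; first by case: (act_main a).2.
  move=> i; rewrite nth_set_nth /=; case: (act_main a).1 => [d|] /=; rewrite vmp.
    by case: (eqVneq i mp) => [->|].
  by case: (eqVneq i mp) => [->|].
- rewrite hqp orbF; split; first by case: (act_plain a).2.
  move=> i; rewrite nth_set_nth /=; case: (act_plain a).1 => [d|] /=.
    by case: (eqVneq i qp) => [->|_]; [split | exact: vqp].
  by case: (eqVneq i qp) => [->|_]; [split | exact: vqp].
- rewrite hzp orbF; split; first by case: (act_addr a).2.
  move=> i; rewrite nth_set_nth /=.
  by case: (eqVneq i ap) => [->|_]; [| exact: vzp].
Qed.

Definition aconfig1 : aconfig :=
  A PInit1 0 0 1
    (fun i => (if i == 0 then Some false else None, no_digits)) 0 (fun=> None).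

Lemma represents_first w : 0 < size w -> represents (step w (init tm)) aconfig1.
Proof.
case: w => // l w _; rewrite /step /= /address big_ord0 /=.
split=> /=; rewrite ?ffunE /=; split=> //.
- by case=> [|i]; rewrite /= ?nth_nil bit0.
- move=> i; case: i => [|i] /=; first by [].
  by rewrite nth_nil.
- by move=> i; case: i => [|i] //=; rewrite ?ffunE ?nth_nil.
- by move=> i; case: i => [|i] //=; rewrite ?ffunE ?nth_nil.
Qed.

Lemma tm_verdict w t b : 0 < size w ->
  aphase (iter t (astep w) aconfig1) = PHalt b ->
  verdict (cstate (iter t.+1 (step w) (init tm))) = Some b.
Proof.
move=> w_gt0 halt; rewrite iterSr.
have : represents (iter t (step w) (step w (init tm))) (iter t (astep w) aconfig1).
  by elim: t {halt} => [|t IH]; [exact: represents_first | exact: represents_step].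
by case=> -[/= -> _]; rewrite halt.
Qed.

End Transition.

Lemma setbit_cat x k b y : x < 2 ^ k ->
  setbit (x + 2 ^ k * y) k b = x + 2 ^ k * (b + y./2.*2).
Proof.
move=> lt_x; apply: bit_inj => i; rewrite bit_setbit !bit_cat //.
case: (ltngtP i k) => // [ltki|->]; last first.
  by rewrite subnn bit_zero oddD odd_double oddb addbF.
have -> : i - k = (i - k).-1.+1 by lia.
rewrite !bitS; congr bit; case: b; lia.
Qed.

Lemma setbit_pos k b y : setbit (2 ^ k * y) k b = 2 ^ k * (b + y./2.*2).
Proof. by rewrite -[2 ^ k * y]add0n setbit_cat ?expn_gt0. Qed.

Lemma setbit0 p : setbit 0 p true = 2 ^ p.
Proof. by have := setbit_pos p true 0; rewrite muln0 muln1. Qed.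

Lemma setbit_pow p : setbit (2 ^ p) p false = 0.
Proof. by have := setbit_pos p false 1; rewrite muln1 muln0. Qed.

(** * Loops of the machine: length of the input, rewinding, incrementing the address *)

Section Loops.

Variable dec : nat -> nat -> nat -> relation -> bool.
Variable w : seq symbol.

Local Notation N := (size w).
Local Notation run t c := (iter t (astep dec w) c).

Definition high (p : nat) : nat := 2 ^ p * (N.-1 %/ 2 ^ p).

Lemma high_half p : (N.-1 %/ 2 ^ p)./2 = N.-1 %/ 2 ^ p.+1.
Proof. by rewrite expnSr divnMA divn2. Qed.

Local Notation P := (up_log 2 N).

Lemma in_range v : (onth w v != None) = (v < N).
Proof. by rewrite -onthTE; case: (onth w v). Qed.

Lemma N_le : N <= 2 ^ P. Proof. exact: up_logP. Qed.

Lemma N_gt p : p < P -> 2 ^ p < N.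
Proof. by move=> ltpP; rewrite ltnNge; apply/negP => /(up_log_min (isT : 1 < 2)); lia. Qed.

Definition plain0 : nat -> option bool := fun=> None.

Definition blank_main (k : nat) : nat -> mdata :=
  fun j => (if j < k then Some false else None, no_digits).

Lemma blank_mainS k :
  upd (blank_main k) k (Some (Some false, no_digits)) = blank_main k.+1.
Proof.
apply: functional_extensionality => j; rewrite /blank_main /= ltnS.
by rewrite [in RHS]leq_eqVlt; case: eqP.
Qed.

Lemma run_up p : p <= P ->
  run (P - p).+1.*2 (A PUpSet p 0 p.+2 (blank_main p.+2) 0 plain0)
  = A PDown P 0 P.+2 (blank_main P.+2) 0 plain0.
Proof.
move=> lepP; move: {2}(P - p) (erefl (P - p)) => k.
elim: k p lepP => [|k IH] p lepP dk; rewrite dk doubleS 2!iterSr.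
  have -> : p = P by lia.
  by rewrite /= setbit0 onth_default ?N_le //= setbit_pow.
have -> : astep dec w (astep dec w (A PUpSet p 0 p.+2 (blank_main p.+2) 0 plain0))
    = A PUpSet p.+1 0 p.+3 (blank_main p.+3) 0 plain0.
  rewrite -(blank_mainS p.+2) /= setbit0; have := in_range (2 ^ p); rewrite N_gt; last by lia.
  by case: (onth w (2 ^ p)) => // a _ /=; rewrite setbit_pow.
have -> : k = P - p.+1 by lia.
by apply: IH; lia.
Qed.

(* The bits of N - 1 are shifted by two cells, so as to face those of the fields:
   the digits in the first two cells of the numerals form the tags. *)
Definition extent (p j : nat) : option bool :=
  if j < 2 then Some false
  else if j < P.+2 then Some ((p <= j - 2) && bit N.-1 (j - 2)) else None.

Definition length_main (p : nat) : nat -> mdata := fun j => (extent p j, no_digits).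

Lemma length_main_blank : length_main P = blank_main P.+2.
Proof.
apply: functional_extensionality => j; rewrite /length_main /extent /blank_main.
case: ltnP => [ltj2|le2j]; first by rewrite ifT //; lia.
by case: ltnP => // ltj; rewrite leqNgt (_ : j - 2 < P) //; lia.
Qed.

Lemma length_mainS p : p < P ->
  upd (length_main p.+1) p.+2 (Some (Some (bit N.-1 p), no_digits)) = length_main p.
Proof.
move=> ltpP; apply: functional_extensionality => j; rewrite /length_main /extent /=.
case: (eqVneq j p.+2) => [->|neq_j].
  by rewrite ltnNge /= !ltnS ltpP subSS subSS subn0 leqnn.
case: ltnP => // le2j; case: ltnP => // _; congr (Some (_ && _), _); lia.
Qed.

Lemma high_step p b : setbit (high p.+1) p b = 2 ^ p * (b + (N.-1 %/ 2 ^ p)./2.*2).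
Proof.
by rewrite /high -high_half expnSr -mulnA mul2n setbit_pos doubleK.
Qed.

Lemma high_bit p : setbit (high p.+1) p (bit N.-1 p) = high p.
Proof. by rewrite high_step odd_double_half. Qed.

(** An address holds a letter iff it is at most N - 1. With the higher bits of N - 1 already in
    place, a trial bit therefore stays in range iff N - 1 has it. *)
Lemma high_test p : 0 < N -> (setbit (high p.+1) p true < N) = bit N.-1 p.
Proof.
move=> N_gt0; rewrite high_step; have -> a : (a < N) = (a <= N.-1) by lia.
rewrite mulnC -leq_divRL ?expn_gt0 // /bit.
by have := odd_double_half (N.-1 %/ 2 ^ p); lia.
Qed.

Lemma highP : high P = 0.
Proof. by rewrite /high divn_small ?muln0 //; have := N_le; lia. Qed.

Lemma run_down p : p <= P -> 0 < N ->
  run (3 * p).+1 (A PDown p (high p) p.+2 (length_main p) 0 plain0)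
  = A PClear 0 N.-1 2 (length_main 0) 0 plain0.
Proof.
move=> lepP N_gt0; elim: p lepP => [|p IH] lepP.
  by rewrite /= /high mul1n divn1.
have -> : (3 * p.+1).+1 = (3 * p).+1 + 3 by lia.
rewrite iterD; have -> : run 3 (A PDown p.+1 (high p.+1) p.+3 (length_main p.+1) 0 plain0)
    = A PDown p (high p) p.+2 (length_main p) 0 plain0.
  rewrite -(length_mainS lepP) -[in RHS](high_bit p) /= in_range high_test //.
  congr (A _ _ _ _ _ _ _).
  apply: bit_inj => i; rewrite !bit_setbit; by case: eqP.
by apply: IH; lia.
Qed.

Lemma run_clear p : p <= P ->
  run (P - p).+1 (A PClear p (high p) p.+2 (length_main 0) 0 plain0)
  = A (PRewind (@Ordinal 4 0 isT)) P 0 P.+2 (length_main 0) 0 plain0.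
Proof.
move=> lepP; move: {2}(P - p) (erefl (P - p)) => k.
elim: k p lepP => [|k IH] p lepP dk; rewrite dk iterSr.
  have -> : p = P by lia.
  by rewrite highP /= /extent /= ltnn.
have ltpP : p < P by lia.
have -> : astep dec w (A PClear p (high p) p.+2 (length_main 0) 0 plain0)
    = A PClear p.+1 (high p.+1) p.+3 (length_main 0) 0 plain0.
  rewrite /= /extent /= !ltnS ltpP /=; congr (A _ _ _ _ _ _ _).
  by rewrite /high setbit_pos high_half; set y := N.-1 %/ _; rewrite expnSr -mulnA mul2n.
have -> : k = P - p.+1 by lia.
by apply: IH; lia.
Qed.

Lemma run_rewind k ap av mp mc qp qc :
  run (maxn ap (maxn mp qp)).+1 (A (PRewind k) ap av mp mc qp qc)
  = A (rewind_next k) 0 av 0 mc 0 qc.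
Proof.
move: {2}(maxn _ _) (erefl (maxn ap (maxn mp qp))) => d.
elim: d ap mp qp => [|d IH] ap mp qp dE; rewrite dE iterSr.
  have [-> -> ->] : [/\ ap = 0, mp = 0 & qp = 0] by split; lia.
  by [].
have -> : astep dec w (A (PRewind k) ap av mp mc qp qc)
    = A (PRewind k) ap.-1 av mp.-1 mc qp.-1 qc.
  have nz : [&& ap == 0, mp == 0 & qp == 0] = false by lia.
  by rewrite /= nz.
have -> : d = maxn ap.-1 (maxn mp.-1 qp.-1) by lia.
by apply: IH; lia.
Qed.

(* The potential that makes the amortised cost of an increment constant. *)
Definition pop (v : nat) : nat := count id (numeral v).

Lemma pop_rec v : pop v = odd v + pop v./2.
Proof.
rewrite /pop; case: (posnP v) => [->|v_gt0]; first by rewrite numeral0.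
by rewrite numeral_rec.
Qed.

(** Crude, but sufficient: overlong numerals are rejected, so only addresses of size O(log N) are
    visited. *)
Lemma pop_le v : pop v <= v.
Proof.
elim/ltn_ind: v => v IH; case: (posnP v) => [->|v_gt0]; first by rewrite /pop numeral0.
by rewrite pop_rec; have := IH v./2; have := odd_double_half v; lia.
Qed.

(** The induction is over the part v of the address above position p, the cells below having been
    cleared by the carry. The number k of trailing ones is paid for by the drop of [pop]. *)
Lemma run_incr r p v mp mc qp qc : exists k,
  run k.+1 (A (PIncr r) p (2 ^ p * v) mp mc qp qc)
  = A (PBack r) (p + k) (2 ^ p * v.+1) mp mc qp qc
  /\ pop v.+1 + k = (pop v).+1.
Proof.
elim/ltn_ind: v p => v IH p.
have bitE : bit (2 ^ p * v) p = odd v.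
  by have := @bit_cat 0 v p p; rewrite ltnn subnn bit_zero => <-; rewrite ?expn_gt0.
case odd_v: (odd v); last first.
  exists 0; rewrite /= bitE odd_v /= setbit_pos addn0; split.
    by congr (A _ _ (_ * _) _ _ _ _); lia.
  by rewrite addn0 pop_rec [in RHS]pop_rec /= odd_v uphalfE -?halfE; congr (_ + pop _); lia.
have [k [runk popk]] := IH v./2 (ltac:(lia)) p.+1.
exists k.+1; rewrite iterSr.
have -> : astep dec w (A (PIncr r) p (2 ^ p * v) mp mc qp qc)
    = A (PIncr r) p.+1 (2 ^ p.+1 * v./2) mp mc qp qc.
  rewrite /= bitE odd_v /= setbit_pos; congr (A _ _ _ _ _ _ _).
  by rewrite expnSr -mulnA mul2n.
rewrite runk; split.
  by rewrite addSnnS expnSr -mulnA mul2n; congr (A _ _ (_ * _) _ _ _ _); lia.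
rewrite pop_rec [in RHS]pop_rec odd_v /= odd_v /=.
have -> : uphalf v = v./2.+1 by rewrite uphalf_half odd_v.
by move: popk; lia.
Qed.

Lemma run_back r p v mp mc qp qc :
  run p.+1 (A (PBack r) p v mp mc qp qc) = A (PRead r) 0 v mp mc qp qc.
Proof. by elim: p => [|p IH] //; rewrite iterSr. Qed.

Lemma run_next r v mp mc qp qc : exists t,
  run t (A (PIncr r) 0 v mp mc qp qc) = A (PRead r) 0 v.+1 mp mc qp qc
  /\ t + (pop v.+1).*2 = (pop v).*2 + 4.
Proof.
have [k [runk popk]] := run_incr r 0 v mp mc qp qc.
rewrite expn0 !mul1n add0n in runk.
by exists (k.+1 + k.+1); rewrite iterD runk run_back; split=> //; lia.
Qed.

End Loops.

Arguments extent : simpl never.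

(** * Reading the three numerals *)

Section Reading.

Variable dec : nat -> nat -> nat -> relation -> bool.
Variable w : seq symbol.

Local Notation N := (size w).
Local Notation P := (up_log 2 N).
Local Notation run t c := (iter t (astep dec w) c).

(** With two bits per cell, cells 0 and 1 hold the four tag bits and cell j + 2 holds bit j of both
    fields. *)
Definition read_main (l : 'I_3 -> seq bool) : nat -> mdata :=
  fun j => (extent w 0 j,
            [ffun s => (nth false (l s) j.*2, nth false (l s) j.*2.+1)]).

Definition set_numeral (l : 'I_3 -> seq bool) (s : 'I_3) (x : seq bool) : 'I_3 -> seq bool :=
  fun i => if i == s then x else l i.

Definition reading (s : 'I_3) (l : 'I_3 -> seq bool) (v : nat) : aconfig :=
  A (PRead (s, canonical (l s), odd (size (l s)))) 0 v
    (size (l s))./2 (read_main l) (size (l s2)) (onth (l s2)).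

Lemma set_numeral_id l s : set_numeral l s (l s) = l.
Proof. by apply: functional_extensionality => i; rewrite /set_numeral; case: eqP => [->|]. Qed.

Lemma set_numeral2 l s x y : set_numeral (set_numeral l s x) s y = set_numeral l s y.
Proof. by apply: functional_extensionality => i; rewrite /set_numeral; case: eqP. Qed.

Lemma set_numeral_eq l s x : set_numeral l s x s = x.
Proof. by rewrite /set_numeral eqxx. Qed.

Lemma read_main_rcons l s b :
  let k := (size (l s))./2 in
  upd (read_main l) k (Some ((read_main l k).1,
    [ffun i => if i == s
               then (if odd (size (l s)) then (((read_main l k).2 i).1, b) else (b, false))
               else (read_main l k).2 i]))
  = read_main (set_numeral l s (rcons (l s) b)).
Proof.
move=> k; apply: functional_extensionality => j /=.
have sizeE := odd_double_half (size (l s)); rewrite -/k in sizeE.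
case: (eqVneq j k) => [->|neq_jk].
  congr (_, _); apply/ffunP => i; rewrite !ffunE /set_numeral.
  case: (eqVneq i s) => [->|] //.
  rewrite !nth_rcons; case: ifP => odd_s; rewrite odd_s in sizeE.
    by rewrite -sizeE !add1n ltnS leqnn ltnn eqxx.
  rewrite -sizeE add0n ltnn eqxx; have -> : k.*2.+1 < k.*2 = false by lia.
  by have -> : k.*2.+1 == k.*2 = false by lia.
congr (_, _); apply/ffunP => i; rewrite !ffunE /set_numeral.
case: (eqVneq i s) => [->|] //; rewrite !nth_rcons.
have [ltjk|lekj] := ltnP j k.
  by rewrite !ifT //; lia.
by congr pair; rewrite (@nth_default _ _ (l s)); try lia; do 2?case: ifP => //; lia.
Qed.

Lemma extent_none j : (extent w 0 j == None) = (P.+2 <= j).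
Proof.
rewrite /extent; case: ltnP => [ltj2|_]; first by symmetry; apply/negbTE; lia.
by case: ltnP.
Qed.

Lemma read_bit s l v b :
  onth w v = Some (Some b) -> size (l s) < P.+2.*2 -> exists t,
  run t (reading s l v) = reading s (set_numeral l s (rcons (l s) b)) v.+1
  /\ t + (pop v.+1).*2 = (pop v).*2 + 5.
Proof.
move=> wv size_s; set l' := set_numeral _ _ _.
have [t [runt popt]] := run_next dec w (s, b, ~~ odd (size (l s))) v
  (size (l' s))./2 (read_main l') (size (l' s2)) (onth (l' s2)).
exists t.+1; split; last by lia.
rewrite iterSr; have <- : A (PIncr (s, b, ~~ odd (size (l s)))) 0 v (size (l' s))./2
    (read_main l') (size (l' s2)) (onth (l' s2)) = astep dec w (reading s l v).
  rewrite /= wv; have := extent_none (size (l s))./2.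
  have -> : P.+2 <= (size (l s))./2 = false by lia.
  case e: (extent w 0 _) => [a|] // _.
  have := read_main_rcons l s b; rewrite /= e => <-.
  rewrite /l' set_numeral_eq size_rcons.
  congr (A _ _ _ _ _ _ _).
  - by case: (boolP (odd _)) => /=; lia.
  - by rewrite /set_numeral eq_sym; case: eqP => [<-|] //=; rewrite size_rcons.
  rewrite /set_numeral eq_sym; case: eqP => [<-|] //=.
  apply: functional_extensionality => i /=; rewrite onthE map_rcons nth_rcons size_map onthE.
  case: ltngtP => // lti.
  by rewrite nth_default // size_map ltnW.
rewrite runt /reading; congr (A (PRead (_, _, _)) _ _ _ _ _ _).
  by rewrite /l' set_numeral_eq /canonical last_rcons.
by rewrite /l' set_numeral_eq size_rcons.
Qed.

Lemma drop_cons v (a : symbol) r : drop v w = a :: r -> onth w v = Some a /\ drop v.+1 w = r.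
Proof.
move=> e; split; last by rewrite -add1n -drop_drop e /= drop0.
have ltvN : v < N by move: (congr1 size e); rewrite size_drop /=; lia.
by rewrite -[w](cat_take_drop v) e onth_cat size_takel ?ltnn ?subnn // ltnW.
Qed.

Lemma read_bits s l v bs r :
  drop v w = map Some bs ++ r -> size (l s) + size bs <= P.+2.*2 -> exists t,
  [/\ run t (reading s l v) = reading s (set_numeral l s (l s ++ bs)) (v + size bs),
    t + (pop (v + size bs)).*2 = (pop v).*2 + 5 * size bs
    & drop (v + size bs) w = r].
Proof.
elim: bs l v => [|b bs IH] l v /= drop_v size_s.
  by exists 0; rewrite cats0 set_numeral_id !addn0.
have [wv drop_v1] := drop_cons drop_v.
have [|t [runt popt]] := read_bit (s := s) (l := l) wv; first by lia.
have [|t' [runt' popt' drop_w]] := IH (set_numeral l s (rcons (l s) b)) v.+1 drop_v1.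
  by rewrite set_numeral_eq size_rcons; lia.
exists (t' + t); rewrite iterD runt runt' addnS -addSn set_numeral_eq set_numeral2 cat_rcons.
by split=> //; lia.
Qed.

Lemma span_some (r : seq symbol) : exists bs r',
  r = map Some bs ++ r' /\ (r' = [::] \/ exists r'', r' = None :: r'').
Proof.
elim: r => [|[b|] r [bs [r' [-> r'P]]]]; first by exists [::], [::]; split=> //; left.
  by exists (b :: bs), r'.
by exists [::], (None :: map Some bs ++ r'); split=> //; right; exists (map Some bs ++ r').
Qed.

Lemma span_inj (a b : seq bool) (r r' : seq symbol) :
  (r' = [::] \/ exists r'', r' = None :: r'') ->
  map Some a ++ None :: r = map Some b ++ r' -> a = b /\ r' = None :: r.
Proof.
move=> r'P; elim: a b => [|x a IH] [|y b] //=.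
- by case: r'P => [->|[r'' ->]].
by case=> -> /IH[-> ->].
Qed.

Definition numeral_at (v : nat) (bs : seq bool) (r : seq symbol) : Prop :=
  [/\ drop v w = map Some bs ++ None :: r, canonical bs & size bs <= P.+2.*2].

Lemma read_numeral (s : 'I_3) l v : l s = [::] -> exists t,
  t <= (pop v).*2 + 5 * P.+2.*2 + 1 /\
  ((aphase (run t (reading s l v)) = PHalt false /\ forall bs r, ~ numeral_at v bs r)
   \/ exists bs r, numeral_at v bs r /\
      let l' := set_numeral l s bs in
      run t (reading s l v) = A (PRewind (lift ord0 s)) 0 (v + size bs)
        (size bs)./2 (read_main l') (size (l' s2)) (onth (l' s2))).
Proof.
move=> l_s; have [bs [r [drop_v rP]]] := span_some (drop v w).
have [size_bs|size_bs] := leqP (size bs) P.+2.*2; last first.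
  (* The P + 2 cells of the main tape have room for this many bits; the machine rejects on meeting
     one more. *)
  have drop_v' : drop v w = map Some (take P.+2.*2 bs) ++ map Some (drop P.+2.*2 bs) ++ r.
    by rewrite catA -map_cat cat_take_drop.
  have [|t [runt popt drop_w]] := read_bits (l := l) (s := s) drop_v'.
    by rewrite l_s add0n size_takel // ltnW.
  rewrite size_takel ?(ltnW size_bs) // in runt popt drop_w.
  exists t.+1; split; first by lia.
  left; split; last first.
    move=> bs' r' [drop_bs' _ size_bs']; rewrite drop_v in drop_bs'.
    by have [eqbs _] := span_inj rP (esym drop_bs'); move: size_bs; rewrite -eqbs; lia.
  rewrite iterS runt l_s /=.
  case e: (drop P.+2.*2 bs) => [|b bs']; first by move: (congr1 size e); rewrite size_drop /=; lia.
  rewrite e in drop_w; have [wv _] := drop_cons drop_w.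
  rewrite wv set_numeral_eq size_takel ?(ltnW size_bs) // doubleK.
  by have := extent_none P.+2; rewrite leqnn => /eqP ->.
have [|t [runt popt drop_w]] := read_bits (l := l) (s := s) drop_v; first by rewrite l_s.
rewrite l_s cat0s in runt.
exists t.+1; split; first by lia.
rewrite iterS runt /= set_numeral_eq.
case: rP drop_v drop_w => [->|[r'' ->]] drop_v drop_w.
  left; split; last first.
    by move=> bs' r' [drop_bs' _ _]; rewrite drop_v in drop_bs';
       have [] := span_inj (or_introl erefl) (esym drop_bs').
  have -> : onth w (v + size bs) = None; last by [].
  by apply: onth_default; move: (congr1 size drop_w); rewrite size_drop /=; lia.
have [-> _] := drop_cons drop_w.
case can_bs: (canonical bs); [right | left].
  by exists bs, r''.
split=> // bs' r' [drop_bs' can_bs' _]; rewrite drop_v in drop_bs'.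
have [eqbs _] := span_inj (or_intror (ex_intro _ _ erefl)) (esym drop_bs').
by rewrite -eqbs can_bs' in can_bs.
Qed.

End Reading.

(** * The final pass: comparisons and subtraction bit by bit *)

Definition low_relation (e : quantity -> nat) (j : nat) : relstate :=
  [ffun uv => let x := e uv.1 %% 2 ^ j in let y := e uv.2 %% 2 ^ j in
    (x < y, x < 2 ^ len y, x.+1 == y, x.+1 == y + 2 ^ j)].

Lemma low_relation0 e : low_relation e 0 = rel_init.
Proof. by apply/ffunP => uv; rewrite !ffunE /= expn0 !modn1. Qed.

Lemma low_relationS e j :
  rel_update (low_relation e j) (fun u => bit (e u) j) = low_relation e j.+1.
Proof.
apply/ffunP => -[u v]; rewrite !ffunE /= !modn_bit expnS.
have := ltn_pmod (e u) (expn_gt0 2 j); have := ltn_pmod (e v) (expn_gt0 2 j).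
move: (e u %% _) (e v %% _) => x y lty ltx.
(* A new bit 1 of y makes its length j + 1, so everything fits; a new bit 0 leaves the length of the
   lower part. *)
have lenE := len_snoc lty; have le_len : 2 ^ len y <= 2 ^ j by rewrite leq_exp2l // len_min.
case: (bit (e u) j); case: (bit (e v) j);
  rewrite /= ?mul1n ?mul0n ?addn0 ?lenE ?expnS; congr (_, _, _, _); lia.
Qed.

Lemma low_relation_all e j : (forall u, e u < 2 ^ j) ->
  (fun u v => (low_relation e j (u, v)).1) = compare e.
Proof.
move=> lt_e; apply: functional_extensionality => u; apply: functional_extensionality => v.
by rewrite ffunE /= !modn_small.
Qed.

(* With h the address of the last #, so that n + h = N - 1, this yields the bits
   of n from those of N - 1 and h. *)
Lemma bit_add_carry n h j :
  bit n j = bit (n + h) j (+) bit h j (+) (2 ^ j <= n %% 2 ^ j + h %% 2 ^ j).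
Proof.
rewrite /bit divnD ?expn_gt0 // !oddD oddb.
by case: (odd _); case: (odd _); case: (_ <= _).
Qed.

Lemma carryS n h j (c := 2 ^ j <= n %% 2 ^ j + h %% 2 ^ j) :
  (2 ^ j.+1 <= n %% 2 ^ j.+1 + h %% 2 ^ j.+1) = bit n j && bit h j || c && (bit n j || bit h j).
Proof.
rewrite /c !modn_bit expnS.
have := ltn_pmod n (expn_gt0 2 j); have := ltn_pmod h (expn_gt0 2 j).
move: (n %% _) (h %% _) => x y lty ltx.
by case: (bit n j); case: (bit h j); rewrite /= ?mul1n ?mul0n ?addn0; lia.
Qed.

Section FinalPass.

Variable dec : nat -> nat -> nat -> relation -> bool.
Variable w : seq symbol.

Local Notation N := (size w).
Local Notation P := (up_log 2 N).
Local Notation run t c := (iter t (astep dec w) c).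

Variables (l : 'I_3 -> seq bool) (h : nat).
Hypothesis lt_h : h < N.
Hypothesis size_l : forall s, size (l s) <= P.+2.*2.

Local Notation value s := (bval (l s)).
Local Notation s0 := (@Ordinal 3 0 isT).
Local Notation s1 := (@Ordinal 3 1 isT).
Local Notation n := (N.-1 - h).
Local Notation e := (quantities (value s0) (value s1) (value s2) n).
Local Notation J := (maxn P (size (l s2))).

Let d0 : digits := (read_main w l 0).2.
Let d1 : digits := (read_main w l 1).2.

Lemma quantities_field s c : e (inl (s, c)) = field (value s) c.
Proof.
case: s => -[|[|[|s]]] lt_s //; rewrite /quantities /=;
by case: c; congr (field (bval (l _)) _); apply: val_inj.
Qed.

Definition final (j : nat) : aconfig :=
  A (PFin2 (d0, d1, 2 ^ j <= n %% 2 ^ j + h %% 2 ^ j, low_relation e j))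
    j h j.+2 (read_main w l) j (onth (l s2)).

Lemma extent_bit j : odflt false (extent w 0 j.+2) = bit N.-1 j.
Proof.
rewrite /extent /= !ltnS subSS subSS subn0; case: ltnP => //= lePj.
by rewrite (@bit_small _ P) //; have := N_le w; lia.
Qed.

Lemma final_step j : j < J -> astep dec w (final j) = final j.+1.
Proof.
move=> ltjJ; rewrite /final /=.
have -> : (extent w 0 j.+2 == None) && (onth (l s2) j == None) = false.
  rewrite extent_none !ltnS; apply/negbTE; rewrite negb_and -ltnNge.
  by move: ltjJ; rewrite leq_max -onthTE; case: (onth _ _) => [a|]; rewrite ?orbT //= !orbF.
have addE : n + h = N.-1 by lia.
have xE := bit_add_carry n h j; rewrite addE in xE.
rewrite /= extent_bit -xE carryS -low_relationS; congr (A (PFin2 (_, _, _, _)) _ _ _ _ _ _).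
congr (rel_update _ _); apply: functional_extensionality => -[[s c]|k].
  rewrite quantities_field bit_field ffunE /= -bit_bval -bit_bval.
  by case: c; congr bit; lia.
case: k => -[|[|[|k]]] lt_k //=; last by rewrite bit0.
by rewrite bit_bval odflt_onth.
Qed.

Lemma run_final j : j <= J -> run j (final 0) = final j.
Proof. by elim: j => // j IH ltj; rewrite iterS IH ?final_step // ltnW. Qed.

Lemma tag_ofE s : tag_of d0 d1 s = tag (value s).
Proof.
apply: bit_inj => i; rewrite bit_bval /tag (bit_mod _ 4) bit_bval !ffunE /=.
by case: i => [|[|[|[|i]]]] //=; rewrite nth_nil.
Qed.

(** Numerals have at most 4 + 2 * P bits, so fields have at most P. Only b, taken as a plain number,
    may be longer, whence the maximum in the number of rounds. *)
Lemma quantities_lt u : e u < 2 ^ J.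
Proof.
have lePJ : 2 ^ P <= 2 ^ J by rewrite leq_exp2l // leq_maxl.
case: u => [[s c]|k].
  rewrite quantities_field; apply: leq_trans lePJ; apply: bit_small_ltn => j lePj.
  rewrite bit_field bit_bval nth_default //; apply: leq_trans (size_l s) _; lia.
case: k => -[|[|[|k]]] lt_k //=; last by rewrite expn_gt0.
  by apply: leq_trans (bval_lt _) _; rewrite leq_exp2l // leq_maxr.
by apply: leq_trans lePJ; have := N_le w; lia.
Qed.

Lemma run_final_pass :
  aphase (run J.+3 (A PFin0 0 h 0 (read_main w l) 0 (onth (l s2)))) =
  PHalt (dec (tag (value s0)) (tag (value s1)) (tag (value s2)) (compare e)).
Proof.
rewrite iterS -addn2 iterD.
have -> : run 2 (A PFin0 0 h 0 (read_main w l) 0 (onth (l s2))) = final 0.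
  by rewrite /final low_relation0 expn0 !modn1.
rewrite run_final // /final /=.
have -> : (extent w 0 J.+2 == None) && (onth (l s2) J == None).
  by rewrite extent_none !ltnS leq_maxl onth_default ?leq_maxr.
by rewrite /= !tag_ofE low_relation_all //; apply: quantities_lt.
Qed.

End FinalPass.

(** * The decision on a query, and the running time *)

Definition kind_eqb (k k' : kind) : bool :=
  match k, k' with
  | KIn, KIn | KAnd, KAnd | KOr, KOr | KNot, KNot | KMaj, KMaj => true
  | _, _ => false
  end.

(** T1 and T2 vanish iff t < 16, in which case the tag of t is t itself; the tests on G1 and G2 say
    that a is a gate. Case 2 includes the input tags that [family_gate] turns into [Or]. *)
Definition decide (S : spec) (t a b : nat) (r : relation) : bool :=
  [&& eqv r T1 ZZ, eqv r T2 ZZ, fits r G1 NN, fits r G2 NN &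
    match t with
    | 0 => [&& kind_eqb (sp_kind S a) KIn, lt r G1 NN & eqv r PB G1]
    | 1 => kind_eqb (sp_kind S a) KAnd && eqv r PB ZZ
    | 2 => (kind_eqb (sp_kind S a) KOr || kind_eqb (sp_kind S a) KIn && le r NN G1)
           && eqv r PB ZZ
    | 3 => kind_eqb (sp_kind S a) KNot && eqv r PB ZZ
    | 4 => kind_eqb (sp_kind S a) KMaj && eqv r PB ZZ
    | 5 => [&& fits r H1 NN, fits r H2 NN & sp_wire S a b r]
    | 6 => sp_output S a r
    | _ => false
    end].

Lemma field_eq0 t : (field t false == 0) && (field t true == 0) = (t < 16).
Proof.
apply/andP/idP => [[/eqP t0 /eqP t1]|lt_t].
  by have := @field_bound 0 t; rewrite t0 t1 => /(_ isT isT).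
have lt_f c : field t c < 2 ^ 0 by apply: field_lt; rewrite muln1.
by have := lt_f false; have := lt_f true; rewrite !ltnS !leqn0.
Qed.

Lemma fits_gate n a :
  (field a false < 2 ^ len n) && (field a true < 2 ^ len n) = (a < family_size n).
Proof.
apply/andP/idP => [[lt0 lt1]|lt_a]; first exact: field_bound.
by split; apply: field_lt.
Qed.

Section Decide.

Variable S : spec.
Hypothesis ok : spec_ok S.

Lemma family_gate_input n (g : 'I_(family_size n)) b :
  [&& kind_eqb (sp_kind S (tag g)) KIn, field g false < n & b == field g false] <->
  exists i : 'I_n, b = i /\ family_gate S g = Input i.
Proof.
rewrite /family_gate; split=> [/and3P[]|[i [-> ]]].
  case: (sp_kind S (tag g)) => // _ ltn /eqP->; exists (Ordinal ltn).
  by rewrite insubT.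
case: (sp_kind S (tag g)) => //; case: insubP => // j ltn <- [->].
by rewrite ltn_ord eqxx.
Qed.

Lemma family_gate_logic n (g : 'I_(family_size n)) :
  [/\ kind_eqb (sp_kind S (tag g)) KAnd <-> family_gate S g = And,
      kind_eqb (sp_kind S (tag g)) KOr || kind_eqb (sp_kind S (tag g)) KIn && ~~ (field g false < n)
        <-> family_gate S g = Or,
      kind_eqb (sp_kind S (tag g)) KNot <-> family_gate S g = Not
    & kind_eqb (sp_kind S (tag g)) KMaj <-> family_gate S g = Maj].
Proof.
rewrite /family_gate; case: (sp_kind S (tag g)) => //=; case: insubP => [i ltn _|] /=.
  by rewrite ltn.
by move=> ->.
Qed.

Lemma onth_outputs n b (g : 'I_(family_size n)) :
  onth (outputs (family S n)) b = Some g <-> onth (sp_outputs S n) b = Some (val g).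
Proof.
have <- : map val (outputs (family S n)) = sp_outputs S n.
  rewrite /= pmap_filter; last exact: insubK.
  apply/all_filterP/allP => a /(output_lt ok) lt_a.
  by rewrite /= insubT.
rewrite onth_map; case: (onth _ b) => [h|] //=.
by split=> [[->]|[/val_inj ->]].
Qed.

Lemma decideP n t a b :
  decide S (tag t) (tag a) (tag b) (compare (quantities t a b n)) <->
  exists it, item_code it = t /\ connection (family S n) it a b.
Proof.
rewrite /decide !eqv_compare /fits /= andbA field_eq0 [X in _ && X]andbA fits_gate.
split=> [/and3P[lt_t lt_a]|[it [<- {t}]]].
  rewrite {1}/tag modn_small //.
  have [and_g or_g not_g maj_g] := family_gate_logic (Ordinal lt_a).
  case: t lt_t => [|[|[|[|[|[|[|t]]]]]]] lt_t //.
  - case/(family_gate_input (Ordinal lt_a)) => i [-> gP]; exists IsInput; split=> //.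
    by exists (Ordinal lt_a), i.
  - case/andP=> /and_g gP /eqP->; exists IsAnd; split=> //; by exists (Ordinal lt_a).
  - case/andP=> /or_g gP /eqP->; exists IsOr; split=> //; by exists (Ordinal lt_a).
  - case/andP=> /not_g gP /eqP->; exists IsNot; split=> //; by exists (Ordinal lt_a).
  - case/andP=> /maj_g gP /eqP->; exists IsMaj; split=> //; by exists (Ordinal lt_a).
  - rewrite andbA fits_gate => /andP[lt_b wP]; exists IsWire; split=> //.
    by exists (Ordinal lt_a), (Ordinal lt_b).
  rewrite -(output_onth ok) // => /eqP outP; exists IsOutput; split=> //.
  by exists (Ordinal lt_a); split=> //; apply/onth_outputs.
case: it => /=.
- case=> g [i [-> -> gP]]; rewrite ltn_ord /=; apply/(family_gate_input g i).
  by exists i.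
- case=> g [-> -> gE]; have [gP _ _ _] := family_gate_logic g.
  by rewrite ltn_ord eqxx andbT; apply/gP.
- case=> g [-> -> gE]; have [_ gP _ _] := family_gate_logic g.
  by rewrite ltn_ord eqxx andbT; apply/gP.
- case=> g [-> -> gE]; have [_ _ gP _] := family_gate_logic g.
  by rewrite ltn_ord eqxx andbT; apply/gP.
- case=> g [-> -> gE]; have [_ _ _ gP] := family_gate_logic g.
  by rewrite ltn_ord eqxx andbT; apply/gP.
- case=> g [h [-> -> gh]]; rewrite [X in _ && X]andbA fits_gate !ltn_ord; exact: gh.
case=> g [-> outP]; rewrite ltn_ord -(output_onth ok) //=.
by apply/eqP/onth_outputs.
Qed.

(** Input and output indices are bounded too, so all numerals of a word in the language fit on the
    main tape, and rejecting longer ones loses nothing. *)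
Lemma connection_bound n it a b :
  connection (family S n) it a b -> a < family_size n /\ b < family_size n.
Proof.
have le_n : n < family_size n.
  apply: leq_trans (ltn_len n) _; rewrite /family_size gate_bound leq_exp2l //; lia.
have pos : 0 < family_size n by lia.
case: it => /=.
- by case=> g [i [-> -> _]]; split; [exact: ltn_ord | have := ltn_ord i; lia].
- by case=> g [-> ->].
- by case=> g [-> ->].
- by case=> g [-> ->].
- by case=> g [-> ->].
- by case=> g [h [-> -> _]].
case=> g [-> /onth_outputs outP]; split; first exact: ltn_ord.
have : b < size (sp_outputs S n) by rewrite -onthTE outP.
by have := output_size ok n; lia.
Qed.

Section Run.

Variable w : seq symbol.
Hypothesis w_gt0 : 0 < size w.

Local Notation N := (size w).
Local Notation P := (up_log 2 N).
Local Notation run t c := (iter t (astep (decide S) w) c).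
Local Notation s0 := (@Ordinal 3 0 isT).
Local Notation s1 := (@Ordinal 3 1 isT).

Lemma run_length : exists t, t <= 7 * P + 10
  /\ run t aconfig1 = reading w s0 (fun=> [::]) 0.
Proof.
exists (P.+2.+1 + (P.+1 + ((3 * P).+1 + ((P - 0).+1.*2 + 1)))); split; first by lia.
rewrite !iterD.
have -> : run 1 aconfig1 = A PUpSet 0 0 2 (blank_main 2) 0 plain0.
  by rewrite -blank_mainS /=; congr (A _ _ _ _ _ _ _);
     apply: functional_extensionality => -[|[|j]].
have downE := @run_down (decide S) w P (leqnn P) w_gt0.
have clearE := @run_clear (decide S) w 0 (leq0n P).
rewrite highP in downE; rewrite /high divn1 mul1n subn0 in clearE.
rewrite run_up // -length_main_blank downE clearE.
have -> : P.+3 = (maxn P (maxn P.+2 0)).+1 by lia.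
rewrite run_rewind /reading /=; congr (A _ _ _ _ _ _ _).
  by apply: functional_extensionality => j; congr pair; apply/ffunP => i; rewrite !ffunE !nth_nil.
by apply: functional_extensionality => j; rewrite onth_default.
Qed.

Lemma numeral_at_inj v bs bs' r r' :
  numeral_at w v bs r -> numeral_at w v bs' r' -> bs = bs' /\ r = r'.
Proof.
move=> [e _ _] [e' _ _]; rewrite e in e'.
by have [-> [->]] := span_inj (or_intror (ex_intro _ _ erefl)) e'.
Qed.

Lemma numeral_at_drop v bs r : numeral_at w v bs r -> drop (v + size bs).+1 w = r.
Proof.
case=> e _ _; rewrite -addn1 -addnA addnC -drop_drop e drop_cat size_map.
by rewrite ltnNge leq_addr /= addKn /= drop0.
Qed.

Definition accepted : Prop :=
  exists l0 r0, numeral_at w 0 l0 r0 /\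
  exists l1 r1, numeral_at w (size l0).+1 l1 r1 /\
  exists l2 y, numeral_at w ((size l0).+1 + size l1).+1 l2 y /\
  decide S (tag (bval l0)) (tag (bval l1)) (tag (bval l2))
    (compare (quantities (bval l0) (bval l1) (bval l2) (size y))).

Lemma run_next_numeral (s s' : 'I_3) (l : 'I_3 -> seq bool) v (bs : seq bool) :
  rewind_next (lift ord0 s) = PIncr (s', true, false) ->
  l s' = [::] -> l s2 = [::] -> size bs <= P.+2.*2 ->
  exists t, t <= (pop v).*2 + 4 + P.+2.+1 /\
    run t (A (PRewind (lift ord0 s)) 0 v (size bs)./2 (read_main w l)
             (size (l s2)) (onth (l s2)))
    = reading w s' l v.+1.
Proof.
move=> next_s l_s' l_s2 size_bs.
have [t [runt popt]] := run_next (decide S) w (s', true, false) v 0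
  (read_main w l) 0 (onth (l s2)).
exists (t + (maxn 0 (maxn (size bs)./2 0)).+1); split; first by lia.
have size_l2 : size (l s2) = 0 by rewrite l_s2.
by rewrite iterD size_l2 run_rewind next_s runt /reading l_s' size_l2.
Qed.

Lemma run_verdict : exists t (b : bool),
  [/\ t <= 70 * P + 200, aphase (run t aconfig1) = PHalt b & b <-> accepted].
Proof.
have [t0 [le_t0 run0]] := run_length.
have [t1 [le_t1 [[halt1 no1]|[l0 [r0 [at0 run1]]]]]] :=
  @read_numeral (decide S) w s0 (fun=> [::]) 0 erefl.
  exists (t1 + t0), false; rewrite iterD run0 halt1; split=> //.
    by have := pop_le 0; lia.
  by split=> // -[l0 [r0 [/no1]]].
have [_ _ size_l0] := at0; set L0 := set_numeral _ _ _ in run1.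
have [t1' [le_t1' run1']] := @run_next_numeral s0 s1 L0 (0 + size l0) l0 erefl erefl erefl size_l0.
have [t2 [le_t2 [[halt2 no2]|[l1 [r1 [at1 run2]]]]]] :=
  @read_numeral (decide S) w s1 L0 (0 + size l0).+1 erefl.
  exists (t2 + (t1' + (t1 + t0))), false; rewrite !iterD run0 run1 run1' halt2; split=> //.
    have := pop_le 0; have := pop_le (0 + size l0); have := pop_le (0 + size l0).+1; lia.
  split=> // -[l0' [r0' [at0' [l1 [r1 [at1 _]]]]]].
  have [el0 _] := numeral_at_inj at0 at0'; rewrite -el0 in at1.
  by case/no2: at1.
have [_ _ size_l1] := at1; set L1 := set_numeral _ _ _ in run2.
have [t2' [le_t2' run2']] := @run_next_numeral s1 s2 L1 ((0 + size l0).+1 + size l1) l1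
  erefl erefl erefl size_l1.
have [t3 [le_t3 [[halt3 no3]|[l2 [y [at2 run3]]]]]] :=
  @read_numeral (decide S) w s2 L1 ((0 + size l0).+1 + size l1).+1 erefl.
  exists (t3 + (t2' + (t2 + (t1' + (t1 + t0))))), false.
  rewrite !iterD run0 run1 run1' run2 run2' halt3; split=> //.
    have := pop_le 0; have := pop_le (0 + size l0); have := pop_le (0 + size l0).+1.
    have := pop_le ((0 + size l0).+1 + size l1); have := pop_le ((0 + size l0).+1 + size l1).+1.
    lia.
  split=> // -[l0' [r0' [at0' [l1' [r1' [at1' [l2 [y [at2 _]]]]]]]]].
  have [el0 _] := numeral_at_inj at0 at0'; rewrite -el0 in at1' at2.
  have [el1 _] := numeral_at_inj at1 at1'; rewrite -el1 in at2.
  by case/no3: at2.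
have [_ _ size_l2] := at2; set L2 := set_numeral _ _ _ in run3.
set h := (_ + size l2) in run3.
have size_L s : size (L2 s) <= P.+2.*2 by case: s => -[|[|[|s]]].
have size_w : h + (size y).+1 = N.
  have [dropE _ _] := at2; have := congr1 size dropE; rewrite size_drop size_cat size_map /=.
  by rewrite /h; lia.
have lt_h : h < N by lia.
have final := run_final_pass (decide S) lt_h size_L.
pose t4 := (maxn 0 (maxn (size l2)./2 (size (L2 s2)))).+1.
exists ((maxn P (size (L2 s2))).+3 + (t4 + (t3 + (t2' + (t2 + (t1' + (t1 + t0))))))).
exists (decide S (tag (bval l0)) (tag (bval l1)) (tag (bval l2))
    (compare (quantities (bval l0) (bval l1) (bval l2) (size y)))).
split.
- have := pop_le 0; have := pop_le (0 + size l0); have := pop_le (0 + size l0).+1.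
  have := pop_le ((0 + size l0).+1 + size l1); have := pop_le ((0 + size l0).+1 + size l1).+1.
  by have := size_L s2; rewrite /t4; lia.
- rewrite !iterD run0 run1 run1' run2 run2' run3 run_rewind.
  have <- : N.-1 - h = size y by lia.
  exact: final.
split=> [dec|[l0' [r0' [at0' [l1' [r1' [at1' [l2' [y' [at2' dec]]]]]]]]]].
  by exists l0, r0; split=> //; exists l1, r1; split=> //; exists l2, y.
have [el0 _] := numeral_at_inj at0 at0'; rewrite -el0 in at1' at2' dec.
have [el1 _] := numeral_at_inj at1 at1'; rewrite -el1 in at2' dec.
by have [el2 ey] := numeral_at_inj at2 at2'; rewrite -el2 -ey in dec.
Qed.

Lemma accepted_connection :
  accepted <-> direct_connection_language (family S) w.
Proof.
split=> [[l0 [r0 [at0 [l1 [r1 [at1 [l2 [y [at2]]]]]]]]]|].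
  case/decideP=> it [itE conn]; exists it, (bval l1), (bval l2), y; split=> //.
  have d1 := numeral_at_drop at0; have d2 := numeral_at_drop at1.
  case: at0 at1 at2 => d0 c0 _ [d1' c1 _] [d2' c2 _].
  rewrite add0n d1' in d1; rewrite d2' in d2.
  by rewrite /encode itE !numeral_bval // d2 d1 -d0 drop0.
case=> it [a [b [y [wE conn]]]].
have [lt_a lt_b] := connection_bound conn.
(* The separators make w longer than y, so size y + 1 <= N <= 2 ^ P. *)
have lt_n : len (size y) <= P.
  apply: len_min; apply: leq_trans _ (N_le w); rewrite wE /encode.
  by rewrite !size_cat /= !size_cat /= !size_cat /=; lia.
have size_num v : v < family_size (size y) -> size (numeral v) <= P.+2.*2.
  rewrite size_numeral /family_size gate_bound => /len_min; lia.
have size_it : size (numeral (item_code it)) <= P.+2.*2.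
  rewrite size_numeral; apply: leq_trans (_ : 3 <= _); last by lia.
  by apply: len_min; case: it {conn wE}.
exists (numeral (item_code it)),
  (map Some (numeral a) ++ None :: map Some (numeral b) ++ None :: y).
have at0 : numeral_at w 0 (numeral (item_code it))
    (map Some (numeral a) ++ None :: map Some (numeral b) ++ None :: y).
  by split; rewrite ?canonical_numeral // drop0.
split=> //; exists (numeral a), (map Some (numeral b) ++ None :: y).
have at1 : numeral_at w (size (numeral (item_code it))).+1 (numeral a)
    (map Some (numeral b) ++ None :: y).
  split; rewrite ?canonical_numeral ?size_num //.
  by have := numeral_at_drop at0; rewrite add0n.
split=> //; exists (numeral b), y.
split; first by split; rewrite ?canonical_numeral ?size_num // (numeral_at_drop at1).
by rewrite !bval_numeral; apply/decideP; exists it.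
Qed.

End Run.

Lemma up_log_time N : 0 < N -> up_log 2 N <= (trunc_log 2 N).+1.
Proof.
move=> N_gt0; case: (ltnP 1 N) => [N_gt1|N_le1].
  by rewrite up_log_trunc_log // ltnS leq_trunc_log // leq_pred.
by rewrite (_ : N = 1); [rewrite up_log1 | lia].
Qed.

Lemma time_bound N t : 0 < N ->
  t <= 70 * up_log 2 N + 200 -> t.+1 <= 300 * (trunc_log 2 N).+1.
Proof. by move/up_log_time; lia. Qed.

Lemma family_uniform : dlogtime_uniform (family S).
Proof.
exists (tm (decide S)), 300 => w; case: (posnP (size w)) => [/size0nil->|w_gt0].
  exists 1, false; split; [by [] | by rewrite /= /step /= onth0n |].
  split=> // -[it [a [b [y [/(congr1 size)]]]]].
  by rewrite /encode size_cat /= addnS.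
have [t [b [le_t halt bP]]] := run_verdict w_gt0.
exists t.+1, b; split.
- exact: time_bound w_gt0 le_t.
- exact: tm_verdict halt.
by rewrite bP; apply: accepted_connection.
Qed.

End Decide.

Theorem proposition1p5 : uniform_TC0 psi_graph /\ uniform_TC0 psi_inv_graph.
Proof.
split; [exists (family psi_spec) | exists (family inv_spec)].
  have ok := psi_spec_ok; split.
  - exact: family_well_formed.
  - exact: family_constant_depth.
  - exact: family_polynomial_size.
  - exact: family_uniform.
  - exact: psi_family_computes.
have ok := inv_spec_ok; split.
- exact: family_well_formed.
- exact: family_constant_depth.
- exact: family_polynomial_size.
- exact: family_uniform.
- exact: inv_family_computes.
Qed.
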